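(* Let $\Sigma$ be the $\sigma$-generic front projection of a Legendrian knot. Every Morse complex sequence on $\Sigma$ is equivalent to a Morse complex sequence in $S\bar R$-form and to a Morse complex sequence in $A$-form.
   Context: **Fronts.** $\mathbb R^3$ carries the contact structure $\ker(dz-y\,dx)$; a Legendrian knot is a smooth knot tangent to it. All knots have rotation number $0$. The front projection $\Sigma$ is the image in the $xz$-plane; it is $\sigma$-generic if its only singularities are left cusps, right cusps and transverse double points (crossings), with distinct $x$-coordinates. A strand of $\Sigma$ is a smooth path in $\Sigma$ from a left cusp to a right cusp. A Maslov potential $\mu$ assigns an integer to each strand so that at every cusp the upper strand has value one larger than the lower strand; fix one. A crossing $q$ of $\Sigma$ has degree $|q|=\mu(T)-\mu(B)$, where $T,B$ are the strands crossing at $q$ and $T$ has smaller slope. At a generic $x$ the strands are numbered $1,2,\dots$ from bottom to top. **Ordered chain complexes.** An ordered chain complex is a $\mathbb Z_2$-vector space $C$ with ordered basis $y_1<\dots<y_n$, integer degrees $|y_i|$, and a linear map $\partial$ with $\partial^2=0$, lowering degree by $1$, and $\partial y_j\in\mathrm{span}\{y_i: i<j\}$; $\langle\partial y_j|y_i\rangle$ is the coefficient of $y_i$ in $\partial y_j$. Let $(C,\partial)$, $(C',\partial')$ have bases $y_1<\dots<y_n$ and $y'_1<\dots<y'_m$. They are related by: (1) a *handleslide between $k$ and $l$* ($k>l$) if $n=m$, $|y_k|=|y_l|$ and $y_k\mapsto y'_k+y'_l$, $y_i\mapsto y'_i$ ($i\ne k$) is a chain isomorphism $C\to C'$; (2)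 *interchanging critical values at $k$* if $n=m$ and $y_k\mapsto y'_{k+1}$, $y_{k+1}\mapsto y'_k$, $y_i\mapsto y'_i$ otherwise, is a chain isomorphism; (3) the *death of two generators at $k$* if $m=n-2$, $\langle\partial y_{k+1}|y_k\rangle=1$, and $y'_i\mapsto[y_i]$ ($i<k$), $y'_i\mapsto[y_{i+2}]$ ($i\ge k$) is a chain isomorphism from $C'$ onto the quotient of $C$ by the acyclic subcomplex spanned by $y_{k+1},\partial y_{k+1}$; (4) the *birth of two generators at $k$* if the same holds with the roles of $C$ and $C'$ exchanged. The birth is *simple* if $\partial'y'_{k+1}=y'_k$ and $y'_{k+1}$ is the only basis element $y'$ with $\langle\partial'y'|y'_k\rangle=1$. **Morse complex sequences (MCSs).** An MCS on $\Sigma$ consists of finitely many (explicit) handleslide marks on $\Sigma$, i.e. vertical segments at distinct $x$-values away from the singularities, each joining two strands of equal Maslov potential, and an ordered chain complex for each interval between consecutive events (an event is a singularity of $\Sigma$ or a handleslide mark), from the interval right of the leftmost left cusp to the interval left of the rightmost right cusp. The $i$-th generator corresponds to strand $i$ and has degree the Maslov potential of that strand; the first and last complexes have two generators with $\partial y_2=y_1$; consecutive complexes are related by a handleslide between $k$ and $l$ at a mark between strands $k>l$, by interchanging critical values at $k$ at a crossing of strands $k,k+1$, by a death at $k$ at a right cusp joining strands $k,k+1$, and by a birth at $k$ at a left cusp creating strands $k,k+1$. Only the order of events and the complexes matter, not the exact positions of marks. **Equivalence of MCSs.** Equivalence is the relation generated by the following local replacements, usable in both directions; all events and complexes outside the replaced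 segment are unchanged, and complexes inside are those forced by the prescribed relations between consecutive complexes. Events are listed left to right; $h_{k,l}$ is a mark between strands $k>l$, $c_i$ a crossing of strands $i,i+1$, $d_i$ a right cusp joining strands $i,i+1$, $e_i$ a left cusp creating strands $i,i+1$; put $s(k)=k$ for $k<i$ and $s(k)=k-2$ for $k>i+1$. (a) $h_{k,l}h_{k,l}\leftrightarrow\emptyset$. (b) $h_{k_1,l_1}h_{k_2,l_2}\leftrightarrow h_{k_2,l_2}h_{k_1,l_1}$ if $k_1\ne l_2$ and $k_2\neq l_1$. (c) $h_{a,b}h_{b,c}\leftrightarrow h_{b,c}h_{a,c}h_{a,b}$ for $a>b>c$. (d) $h_{k,l}c_i\leftrightarrow c_ih_{\sigma(k),\sigma(l)}$ with $\sigma$ the transposition $(i\ i{+}1)$ and $(k,l)\ne(i+1,i)$. (e) $h_{k,l}d_i\leftrightarrow d_ih_{s(k),s(l)}$ and $h_{s(k),s(l)}e_i\leftrightarrow e_ih_{k,l}$ for $k,l\notin\{i,i+1\}$ (in the latter the complex immediately right of the birth changes by the handleslide between $k$ and $l$). (f) $h_{k,i+1}d_i\leftrightarrow d_i$ ($k>i+1$); $h_{i,l}d_i\leftrightarrow d_i$ ($l<i$); $e_ih_{k,i+1}\leftrightarrow e_i$ ($k>i+1$) and $e_ih_{i,l}\leftrightarrow e_i$ ($l<i$) (when the mark is removed, the complex immediately right of the birth becomes the complex that was right of the mark). (g) If in a complex of the MCS $l<k$ and $|y_l|=|y_k|+1$, insert or remove the consecutive marks $h_{k,v_r}\cdots h_{k,v_1}h_{u_1,l}\cdots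 h_{u_s,l}$, where $v_r<\dots<v_1$ are all indices $v$ with $\langle\partial y_l|y_v\rangle=1$ and $u_1<\dots<u_s$ all indices $u$ with $\langle\partial y_u|y_k\rangle=1$. **Simple form and the ruling of an MCS.** An ordered chain complex is in simple form if each $\partial y_i$ is $0$ or a single basis element, and distinct $y_i$ have distinct nonzero $\partial y_i$. Every ordered chain complex can be brought to a unique simple form by handleslides; all complexes in an MCS are acyclic, so the simple form of each gives a fixed-point free involution (pairing) of its generators, hence of the strands over the corresponding interval. These pairings form a graded normal ruling $N_{\mathcal C}$ of $\Sigma$; paired strands are called companions, and companion strands bound ruling disks. A crossing of strands $i,i+1$ is a switch of $N_{\mathcal C}$ if the pairing of positions is the same just before and just after it (so the two ruling paths do not cross there); at a switch the vertical slices of the two ruling disks are disjoint or nested. An unswitched crossing is a return if the two ruling disks partially overlap just to its left; a return is graded if the crossing has degree $0$. **$S\bar R$-form.** A switch of $N_{\mathcal C}$ at a crossing $q$ of strands $i,i+1$ is simple if the complexes before and after the following local configuration are in simple form: one handleslide mark between strands $i+1,i$ immediately left of $q$, one handleslide mark between strands $i+1,i$ immediately right of $q$, and, if the two ruling disks are nested at $q$ (the companions of $i$ and $i+1$ lie both above or both below them), one further mark immediately right of $q$ between the companions of strands $i$ and $i+1$; no further mark if the disks are disjoint. A return at a crossing $q$ of strands $i,i+1$ is simple if the complexes before and after the local configuration are in simple form and the configuration is either no handleslide mark at all (unmarked), or (marked) one mark between strands $i+1,i$ immediately left of $q$ together with, if the companions of $i$ and $i+1$ lie both above or both below them, one mark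 immediately right of $q$ between these companions (no second mark if one companion lies above and the other below). An MCS is in $S\bar R$-form if its births are simple, all its switches and graded returns are simple, and it has no handleslide marks besides those near simple switches and returns. **$A$-form.** An MCS is in $A$-form if its births are simple and its only explicit handleslide marks are, near some of the crossings $q$ of $\Sigma$, a single mark immediately left of $q$ between the two strands crossing at $q$. *)

(* Defs.v *)
From Stdlib Require Import Relation_Operators.
From HB Require Import structures.
From mathcomp Require Import all_boot all_order all_algebra.
From mathcomp Require Import classical_sets reals topology normedtype derive.

Set Implicit Arguments.
Unset Strict Implicit.
Unset Printing Implicit Defensive.

Import Order.TTheory GRing.Theory Num.Theory.
Import numFieldNormedType.Exports.

Local Open Scope ring_scope.
Local Open Scope classical_set_scope.

(** A knot is a smooth embedding of the circle R/Z, given by functions on R of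
    period 1; [0, 1) is used as a fundamental domain. *)

Record space_curve (R : realType) := SpaceCurve {
  cx : R -> R;
  cy : R -> R;
  cz : R -> R
}.

Section Fronts.
Variable R : realType.
Implicit Types (K : space_curve R) (f : R -> R) (s t u x z : R).

Definition smooth f := forall n t, derivable (f^`(n)) t 1.

Definition in_circle t := (0 <= t) && (t < 1).

Definition dx K : R -> R := (cx K)^`().
Definition dy K : R -> R := (cy K)^`().
Definition dz K : R -> R := (cz K)^`().
Definition ddx K : R -> R := (cx K)^`(2).

Definition legendrian_knot K : Prop :=
  [/\ [/\ smooth (cx K), smooth (cy K) & smooth (cz K)],
      forall t, [/\ cx K (t + 1) = cx K t, cy K (t + 1) = cy K t
                  & cz K (t + 1) = cz K t],
      forall s t, in_circle s -> in_circle t ->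
        cx K s = cx K t -> cy K s = cy K t -> cz K s = cz K t -> s = t,
      forall t, [|| dx K t != 0, dy K t != 0 | dz K t != 0]
    & forall t, dz K t = cy K t * dx K t].

Definition front K t : R * R := (cx K t, cz K t).

(** Since z' = y x', the front is not immersed at t exactly when x'(t) = 0; the
    singularity there is a semicubical cusp exactly when moreover
    x''(t) <> 0, with the branches to the right of the cusp if x''(t) > 0. *)
Definition left_cusp K t := dx K t = 0 /\ 0 < ddx K t.
Definition right_cusp K t := dx K t = 0 /\ ddx K t < 0.

Definition double_point K s t :=
  [/\ in_circle s, in_circle t, s != t & front K s = front K t].

Definition singular_point K (p : R * R) : Prop :=
  (exists t, dx K t = 0 /\ p = front K t) \/
  (exists s t, double_point K s t /\ p = front K s).

Definition sigma_generic K : Prop :=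
  [/\ forall t, dx K t = 0 -> left_cusp K t \/ right_cusp K t,
      forall s t, double_point K s t ->
        [/\ dx K s != 0, dx K t != 0
          & dx K s * dz K t != dz K s * dx K t],
      forall s t u, double_point K s t -> double_point K t u -> u = s
    & forall p q, singular_point K p -> singular_point K q -> p.1 = q.1 -> p = q].

(** Strands are the arcs of the circle between consecutive cusps, so a Maslov
    potential is a function of the parameter that is constant on cusp-free
    intervals; its values at the cusp parameters are irrelevant. Two parameters
    close to a cusp and with the same value of x lie on its two branches. *)
Definition maslov_potential K (mu : R -> int) : Prop :=
  [/\ forall t, mu (t + 1) = mu t,
      forall s t, s < t ->
        (forall u, s <= u -> u <= t -> dx K u != 0) -> mu s = mu t
    & forall c, dx K c = 0 -> exists2 e, 0 < e &
        forall s t, `|s - c| < e -> `|t - c| < e ->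
          cx K s = cx K t -> cz K s < cz K t -> mu t = mu s + 1].

(** The parameters of the points of the front with first coordinate x, from
    bottom to top. *)
Definition slice K x (ts : seq R) : Prop :=
  sorted (fun s t => cz K s < cz K t) ts /\
  (forall t, t \in ts <-> in_circle t /\ cx K t = x).

Definition num_below K x z (i : nat) : Prop :=
  exists ts : seq R, [/\ uniq ts, size ts = i &
    forall t, t \in ts <-> [/\ in_circle t, cx K t = x & cz K t < z]].

End Fronts.

(** Row j of [bd] is the boundary of the generator y_j, and linear maps act on
    row vectors from the right. Generators, like the strands of a front, are
    numbered from 0, and generator indices are natural numbers, so that maps
    between complexes of different rank need no casts. *)

Record occ := Occ {
  rank : nat;
  deg : rank.-tuple int;
  bd : 'M['F_2]_rank
}.

Definition degn (C : occ) (k : nat) : int := nth 0 (deg C) k.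

(** <d y_j | y_i> = 1. *)
Definition incid (C : occ) (j i : nat) : bool :=
  [exists a : 'I_(rank C), exists b : 'I_(rank C),
    [&& a == j :> nat, b == i :> nat & bd C a b == 1]].

Definition gen (C : occ) (k : nat) : 'rV['F_2]_(rank C) :=
  \row_j (j == k :> nat)%:R.

Definition is_occ (C : occ) : Prop :=
  bd C *m bd C = 0 /\
  forall j i : 'I_(rank C), bd C j i != 0 ->
    (i < j)%N /\ tnth (deg C) j = tnth (deg C) i + 1.

Definition degree_preserving (C C' : occ) (P : 'M['F_2]_(rank C, rank C')) :=
  forall i j, P i j != 0 -> tnth (deg C) i = tnth (deg C') j.

Definition chain_iso (C C' : occ) (P : 'M['F_2]_(rank C, rank C')) : Prop :=
  [/\ row_free P, row_full P, degree_preserving P & bd C *m P = P *m bd C'].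

(** The map from [C'] to the quotient of [C] by the row space of [S] induced by
    [J] is an isomorphism of chain complexes. *)
Definition chain_iso_quotient (C' C : occ) m (J : 'M['F_2]_(rank C', rank C))
    (S : 'M['F_2]_(m, rank C)) : Prop :=
  [/\ degree_preserving J,
      (bd C' *m J - J *m bd C <= S)%MS,
      forall v : 'rV_(rank C'), (v *m J <= S)%MS -> v = 0
    & forall w : 'rV_(rank C), exists v : 'rV_(rank C'), (w - v *m J <= S)%MS].

Definition handleslide (k l : nat) (C C' : occ) : Prop :=
  [/\ rank C = rank C', (l < k < rank C)%N, degn C k = degn C l &
    chain_iso (\matrix_(i < rank C, j < rank C')
      ((j == i :> nat) || ((i == k :> nat) && (j == l :> nat)))%:R)].

Definition transp (i j : nat) : nat :=
  if j == i then i.+1 else if j == i.+1 then i else j.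

Definition interchange (k : nat) (C C' : occ) : Prop :=
  [/\ rank C = rank C', (k.+1 < rank C)%N &
    chain_iso (\matrix_(i < rank C, j < rank C') (j == transp k i :> nat)%:R)].

Definition death (k : nat) (C C' : occ) : Prop :=
  [/\ rank C = (rank C').+2, (k.+1 < rank C)%N, incid C k.+1 k &
    chain_iso_quotient
      (\matrix_(i < rank C', j < rank C)
         (j == (if i < k then i : nat else i.+2)%N :> nat)%:R)
      (col_mx (gen C k.+1) (gen C k.+1 *m bd C))].

Definition birth (k : nat) (C C' : occ) : Prop := death k C' C.

(** Here [C] is the complex immediately after the birth. *)
Definition simple_birth (k : nat) (C : occ) : Prop :=
  gen C k.+1 *m bd C = gen C k /\ forall j, incid C j k -> j = k.+1.

Definition simple_form (C : occ) : Prop :=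
  (forall i, row i (bd C) = 0 \/ exists j, row i (bd C) = delta_mx 0 j) /\
  (forall i j, row i (bd C) != 0 -> row i (bd C) = row j (bd C) -> i = j).

Definition handleslides : occ -> occ -> Prop :=
  clos_refl_trans occ (fun C C' => exists k l, handleslide k l C C').

Definition companions (C : occ) (a b : nat) : Prop :=
  exists D, [/\ handleslides C D, simple_form D & incid D a b || incid D b a].

Definition elementary (C : occ) : Prop :=
  rank C = 2%N /\ gen C 1 *m bd C = gen C 0.

Inductive event :=
| Hs of nat & nat   (* handleslide mark between strands k > l *)
| Cr of nat         (* crossing of strands i and i + 1 *)
| Rc of nat         (* right cusp joining strands i and i + 1 *)
| Lc of nat         (* left cusp creating strands i and i + 1 *).

Definition is_mark (e : event) : bool := if e is Hs _ _ then true else false.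

Definition step (e : event) (C C' : occ) : Prop :=
  match e with
  | Hs k l => handleslide k l C C'
  | Cr i => interchange i C C'
  | Rc i => death i C C'
  | Lc i => birth i C C'
  end.

(** Each event comes with the complex immediately to its right. The leftmost
    left cusp and the rightmost right cusp are not listed. *)
Record mcs := Mcs {
  start : occ;
  tail : seq (event * occ)
}.

Definition events (q : seq (event * occ)) : seq event := [seq p.1 | p <- q].

Definition final (C : occ) (q : seq (event * occ)) : occ :=
  last C [seq p.2 | p <- q].

Definition complexes (M : mcs) : seq occ := start M :: [seq p.2 | p <- tail M].

Definition num_singularities (q : seq (event * occ)) : nat :=
  count (fun e => ~~ is_mark e) (events q).

Definition front_word (M : mcs) : seq event :=
  Lc 0 :: [seq e <- events (tail M) | ~~ is_mark e] ++ [:: Rc 0].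

Fixpoint steps (C : occ) (q : seq (event * occ)) : Prop :=
  if q is (e, D) :: q' then step e C D /\ steps D q' else True.

Section MCS.
Variable R : realType.
Implicit Types (K : space_curve R) (mu : R -> int) (xs : seq R).

(** The position of a singularity of the front is the number of points of the
    front vertically below it. *)
Definition singularity_at K (x : R) (e : event) : Prop :=
  match e with
  | Hs _ _ => False
  | Lc i => exists t, [/\ left_cusp K t, cx K t = x & num_below K x (cz K t) i]
  | Rc i => exists t, [/\ right_cusp K t, cx K t = x & num_below K x (cz K t) i]
  | Cr i => exists s t,
      [/\ double_point K s t, cx K s = x & num_below K x (cz K s) i]
  end.

(** [xs] lists the x-coordinates of the singularities from left to right, and
    [w] their types and positions. *)
Definition front_reading K xs (w : seq event) : Prop :=
  [/\ sorted <%R xs,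
      forall x, x \in xs <-> (exists2 p, singular_point K p & p.1 = x),
      size xs = size w
    & forall j, (j < size w)%N -> singularity_at K (nth 0 xs j) (nth (Lc 0) w j)].

Definition is_mcs K mu (M : mcs) : Prop :=
  [/\ forall p, (p <= size (tail M))%N -> is_occ (nth (start M) (complexes M) p),
      steps (start M) (tail M),
      elementary (start M), elementary (final (start M) (tail M))
    & exists2 xs, front_reading K xs (front_word M) &
        forall p x, (p <= size (tail M))%N ->
          let j := num_singularities (take p (tail M)) in
          nth 0 xs j < x < nth 0 xs j.+1 ->
          exists2 ts, slice K x ts &
            deg (nth (start M) (complexes M) p) = [seq mu t | t <- ts] :> seq int].

Definition cusp_shift (i k : nat) : nat := if (k < i)%N then k else k.-2.

(** The replacements of words of events; the complex to the left of the
    replaced word is [A]. Only the insertion of marks prescribed by the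
    boundary map depends on [A]. *)
Inductive local_move (A : occ) : seq event -> seq event -> Prop :=
| MoveCancel k l : local_move A [:: Hs k l; Hs k l] [::]
| MoveCommute k1 l1 k2 l2 : k1 <> l2 -> k2 <> l1 ->
    local_move A [:: Hs k1 l1; Hs k2 l2] [:: Hs k2 l2; Hs k1 l1]
| MoveTriangle a b c : (c < b)%N -> (b < a)%N ->
    local_move A [:: Hs a b; Hs b c] [:: Hs b c; Hs a c; Hs a b]
| MoveCrossing k l i : (k, l) <> (i.+1, i) ->
    local_move A [:: Hs k l; Cr i] [:: Cr i; Hs (transp i k) (transp i l)]
| MoveRightCusp k l i :
    k <> i -> k <> i.+1 -> l <> i -> l <> i.+1 ->
    local_move A [:: Hs k l; Rc i]
                 [:: Rc i; Hs (cusp_shift i k) (cusp_shift i l)]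
| MoveLeftCusp k l i :
    k <> i -> k <> i.+1 -> l <> i -> l <> i.+1 ->
    local_move A [:: Hs (cusp_shift i k) (cusp_shift i l); Lc i]
                 [:: Lc i; Hs k l]
| MoveRightCuspAbove k i : (i.+1 < k)%N ->
    local_move A [:: Hs k i.+1; Rc i] [:: Rc i]
| MoveRightCuspBelow l i : (l < i)%N ->
    local_move A [:: Hs i l; Rc i] [:: Rc i]
| MoveLeftCuspAbove k i : (i.+1 < k)%N ->
    local_move A [:: Lc i; Hs k i.+1] [:: Lc i]
| MoveLeftCuspBelow l i : (l < i)%N ->
    local_move A [:: Lc i; Hs i l] [:: Lc i]
| MoveBoundary k l : (l < k)%N -> (k < rank A)%N -> degn A l = degn A k + 1 ->
    local_move A [::]
      ([seq Hs k v | v <- iota 0 (rank A) & incid A l v] ++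
       [seq Hs u l | u <- iota 0 (rank A) & incid A u k]).

(** The segment [q] is replaced by [q'], which leads to the same complex. *)
Definition mcs_move K mu (M M' : mcs) : Prop :=
  [/\ is_mcs K mu M, is_mcs K mu M' & exists C p q q' r,
      let A := final C p in
      [/\ M = Mcs C (p ++ q ++ r), M' = Mcs C (p ++ q' ++ r),
          final A q = final A q' & local_move A (events q) (events q')]].

Definition mcs_equiv K mu : mcs -> mcs -> Prop :=
  clos_refl_sym_trans mcs (mcs_move K mu).

End MCS.

(** Below, [C] and [D] are the complexes immediately before and after a
    crossing of strands i and i + 1. *)

Definition is_switch (C D : occ) : Prop :=
  forall a b, companions C a b <-> companions D a b.

Definition partial_overlap (i a j b : nat) : bool :=
  [|| (minn i a < minn j b < maxn i a)%N && (maxn i a < maxn j b)%N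
    | (minn j b < minn i a < maxn j b)%N && (maxn j b < maxn i a)%N].

Definition is_return (C : occ) (i : nat) (D : occ) : Prop :=
  ~ is_switch C D /\
  exists a b, [/\ companions C i a, companions C i.+1 b & partial_overlap i a i.+1 b].

(** Immediately to the left of a crossing the strand of smaller slope is the
    upper one. *)
Definition crossing_degree (C : occ) (i : nat) : int := degn C i.+1 - degn C i.

Definition same_side (i a b : nat) : bool :=
  ((a < i) && (b < i) || (i.+1 < a) && (i.+1 < b))%N.

Definition companion_mark (a b : nat) : event := Hs (maxn a b) (minn a b).

(** A local configuration at a crossing of strands i and i + 1, reached from the
    complex [A], consists of the events [p] (with complexes), the crossing, with
    [D] on its right, and the events [r]. *)

Definition simple_switch (A : occ) (p : seq (event * occ)) (i : nat) (D : occ)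
    (r : seq (event * occ)) : Prop :=
  let C := final A p in
  [/\ is_switch C D, simple_form A, simple_form (final D r),
      events p = [:: Hs i.+1 i]
    & exists a b, [/\ companions C i a, companions C i.+1 b &
        if same_side i a b then
          events r = [:: Hs i.+1 i; companion_mark a b] \/
          events r = [:: companion_mark a b; Hs i.+1 i]
        else events r = [:: Hs i.+1 i]]].

Definition simple_return (A : occ) (p : seq (event * occ)) (i : nat) (D : occ)
    (r : seq (event * occ)) : Prop :=
  let C := final A p in
  [/\ is_return C i D, simple_form A, simple_form (final D r) &
    (events p = [::] /\ events r = [::]) \/
    (events p = [:: Hs i.+1 i] /\
     exists a b, [/\ companions C i a, companions C i.+1 b &
       events r = if same_side i a b then [:: companion_mark a b] else [::]])].

(** The crossings that need not be simple carry no marks. *)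
Definition plain_crossing (A : occ) (p : seq (event * occ)) (i : nat) (D : occ)
    (r : seq (event * occ)) : Prop :=
  [/\ p = [::], r = [::], ~ is_switch A D &
      ~ (is_return A i D /\ crossing_degree A i = 0)].

Inductive sr_decomposition : occ -> seq (event * occ) -> Prop :=
| SrNil A : sr_decomposition A [::]
| SrLeftCusp A k B q :
    sr_decomposition B q -> sr_decomposition A ((Lc k, B) :: q)
| SrRightCusp A k B q :
    sr_decomposition B q -> sr_decomposition A ((Rc k, B) :: q)
| SrCrossing A p i D r q :
    simple_switch A p i D r \/ simple_return A p i D r \/
      plain_crossing A p i D r ->
    sr_decomposition (final D r) q ->
    sr_decomposition A (p ++ (Cr i, D) :: r ++ q).

Definition simple_births (M : mcs) : Prop :=
  forall p k B q, tail M = p ++ (Lc k, B) :: q -> simple_birth k B.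

Definition sr_form (M : mcs) : Prop :=
  simple_births M /\ sr_decomposition (start M) (tail M).

Definition a_form (M : mcs) : Prop :=
  simple_births M /\
  forall p k l B q, tail M = p ++ (Hs k l, B) :: q ->
    k = l.+1 /\ exists D q', q = (Cr l, D) :: q'.

(* Main.v *)
(** The handleslide marks are swept from left to right.  The marks swept so far
    form a word of handleslides, modulo the group relations (a)-(c) and the
    boundary marks (g), standing just right of a finished part.
    At a left cusp the word passes, and further marks are pulled out of the cusp
    to make the birth simple.  At a right cusp of strands i, i+1 the only marks
    that neither pass nor are absorbed are h_{k,i} and h_{i+1,l}; as
    <d y_{i+1} | y_i> = 1, such a mark is a factor of a boundary word (g) all of
    whose other factors pass or are absorbed.  At a crossing, conjugation moves
    h_{i+1,i} to the front of the word, where it is left behind if it survives,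
    and the rest passes.  The word that arrives at the last complex is empty,
    because its two generators have different degrees.
    This gives an A-form.  For an SR-form each complex left behind is kept in
    simple form: after a crossing with a surviving mark, one or two further marks
    turn the complex either into the one before the crossing (a switch) or into
    its transposition (a return). *)

From Stdlib Require Import Relation_Operators.
Require Import Defs.
From mathcomp Require Import all_boot all_order all_algebra.
From mathcomp Require Import classical_sets reals topology normedtype derive.
From mathcomp Require Import zify.

Set Implicit Arguments.
Unset Strict Implicit.
Unset Printing Implicit Defensive.

Import Order.TTheory GRing.Theory Num.Theory.

(** Ranks change at cusps and matrix types depend on them, so each relation between neighbouring
    complexes is first rewritten as an identity of boolean incidence functions on natural numbers;
    the chain-level claims then become finite xor computations. The link to the front is kept out of
    the sweep: moves preserve the list of singularities and the degrees, which together with the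
    last complex are all that [is_mcs] needs. No termination measure is required, because nothing
    behind the sweep line is touched again and the part ahead is never altered: the swept word
    always ends at the original complex. The choice at a crossing rests on one identity over F_2:
    for the slide E of strands i+1, i and their transposition T, the product E T E is the opposite
    elementary matrix. At a switch this matrix, and at a return E alone, fixes the simple boundary
    map or changes one entry, which a mark between the companions repairs. Companions must therefore
    exist; acyclicity enters only as the statement that every generator of a simple form is
    paired. *)

(** * Boundary maps over F_2 as boolean incidence relations *)

Lemma F2_natrE (x : 'F_2) : x = (x == 1%R)%:R%R.
Proof. by case: x => [[|[|?]] ?] //; apply/val_inj. Qed.

Lemma F2_neq0 (x : 'F_2) : (x != 0%R) = (x == 1%R).
Proof. by case: x => [[|[|?]] ?]. Qed.

Lemma F2_addxx (x : 'F_2) : (x + x = 0)%R.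
Proof. by apply: addrr_pchar2; apply: pchar_Fp. Qed.

Lemma F2_eq1D (x y : 'F_2) : ((x + y)%R == 1%R) = (x == 1%R) (+) (y == 1%R).
Proof. by case: x y => [[|[|?]] ?] // [[|[|?]] ?]. Qed.

Lemma F2_eq1M (x y : 'F_2) : ((x * y)%R == 1%R) = (x == 1%R) && (y == 1%R).
Proof. by case: x y => [[|[|?]] ?] // [[|[|?]] ?]. Qed.

Lemma F2_eq1_nat (b : bool) : ((b%:R : 'F_2) == 1)%R = b.
Proof. by case: b. Qed.

Lemma F2_eq1_sum I (r : seq I) (P : pred I) (F : I -> 'F_2) :
  ((\sum_(i <- r | P i) F i)%R == 1%R) =
  \big[addb/false]_(i <- r | P i) (F i == 1%R).
Proof.
apply: (big_morph (fun x : 'F_2 => x == 1%R)) => //.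
exact: F2_eq1D.
Qed.

Lemma F2_mx_addxx m n (A : 'M['F_2]_(m, n)) : (A + A = 0)%R.
Proof. by apply/matrixP => i j; rewrite !mxE F2_addxx. Qed.

Lemma incid_ord C (a b : 'I_(rank C)) : incid C a b = (bd C a b == 1%R).
Proof.
apply/existsP/idP => [[a' /existsP[b' /and3P[/eqP/val_inj-> /eqP/val_inj->]]]//|h].
by exists a; apply/existsP; exists b; rewrite !eqxx.
Qed.

Lemma bdE C (a b : 'I_(rank C)) : bd C a b = (incid C a b)%:R%R.
Proof. by rewrite incid_ord -F2_natrE. Qed.

Lemma incid_rank C j i : incid C j i -> (j < rank C) && (i < rank C).
Proof.
by case/existsP=> a /existsP[b /and3P[/eqP<- /eqP<- _]]; rewrite !ltn_ord.
Qed.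

Lemma incid_ge C j i : (rank C <= j) || (rank C <= i) -> incid C j i = false.
Proof. by move=> h; apply/idP => /incid_rank; lia. Qed.

Lemma degn_ge C k : rank C <= k -> degn C k = 0%R.
Proof. by move=> h; rewrite /degn nth_default // size_tuple. Qed.

Lemma degn_ord C (a : 'I_(rank C)) : degn C a = tnth (deg C) a.
Proof. by rewrite /degn -tnth_nth. Qed.

(** [incid] and [degn] are total on natural numbers, so complexes can be compared without
    transporting a matrix along an equality of ranks. Complexes reached by different words are
    identified in this way. *)
Lemma occ_ext C D : rank C = rank D -> (forall k, degn C k = degn D k) ->
  (forall j i, incid C j i = incid D j i) -> C = D.
Proof.
case: C D => n d b [m e c] /= enm; case: m / enm in e c *.
move=> hd hb; congr Occ.
  by apply: eq_from_tnth => a; have := hd a; rewrite !degn_ord.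
apply/matrixP => i j.
have := hb i j; rewrite (@incid_ord (Occ d b) i j) (@incid_ord (Occ e c) i j) /=.
by move=> E; rewrite [LHS]F2_natrE E -F2_natrE.
Qed.

Lemma occ_incid C : is_occ C ->
  forall j i, incid C j i -> i < j /\ (degn C j = degn C i + 1)%R.
Proof.
case=> _ h j i hji; have /andP[hj hi] := incid_rank hji.
have := h (Ordinal hj) (Ordinal hi).
have -> : bd C (Ordinal hj) (Ordinal hi) = 1%R by rewrite bdE hji.
by case=> // h1 h2; split=> //; have := h2; rewrite -!degn_ord.
Qed.

Lemma occ_incid_ge C j i : is_occ C -> j <= i -> incid C j i = false.
Proof. by move=> h hji; apply/idP => /(occ_incid h)[]; lia. Qed.

(** The square-zero condition as a parity count of two-step paths. Indices beyond the rank are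
    harmless because [incid] is false there. *)
Lemma occ_sq C j i : is_occ C ->
  \big[addb/false]_(m <- iota 0 (rank C) | incid C j m) incid C m i = false.
Proof.
case=> h _; rewrite big_mkcond /=.
case hj : (j < rank C); last first.
  by apply: big1 => m _; rewrite incid_ge // leqNgt hj.
case hi : (i < rank C); last first.
  by apply: big1 => m _; rewrite [incid C m i]incid_ge ?if_same // orbC leqNgt hi.
rewrite -[X in iota _ X]subn0 -/(index_iota _ _) big_mkord.
have := congr1 (fun A : 'M_(rank C) => A (Ordinal hj) (Ordinal hi) == 1%R) h.
rewrite !mxE F2_eq1_sum /= => E; rewrite -[RHS]E; apply: eq_bigr => m _.
by rewrite F2_eq1M -!incid_ord /=; case: incid.
Qed.

(** * Elementary matrices and handleslides *)

(** The body repeats the matrix inside [handleslide], so that the two are convertible once the ranks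
    agree. *)
Definition elem n k l : 'M['F_2]_n :=
  \matrix_(i < n, j < n) ((j == i :> nat) || ((i == k :> nat) && (j == l :> nat)))%:R%R.

Lemma elem_delta n (k l : 'I_n) : l < k -> (elem n k l = 1%:M + delta_mx k l)%R.
Proof.
move=> h; apply/matrixP => i j; rewrite !mxE.
have -> : (j == i :> nat) = (i == j) by rewrite eq_sym.
have -> : (i == k :> nat) = (i == k) by [].
have -> : (j == l :> nat) = (j == l) by [].
case: (eqVneq i j) => [->|_]; last by rewrite add0r; case: (_ && _).
case: eqP => [->|_] /=; last by rewrite addr0.
by case: eqP => [e|_] /=; [rewrite e ltnn in h | rewrite addr0].
Qed.

Lemma elemK n (k l : 'I_n) : l < k -> (elem n k l *m elem n k l = 1%:M)%R.
Proof.
move=> h; rewrite elem_delta // mulmxDl mul1mx mulmxDr mulmx1.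
rewrite mul_delta_mx_0; last by apply: contraTneq h => ->; rewrite ltnn.
by rewrite addr0 -addrA F2_mx_addxx addr0.
Qed.

Definition slidable C (x : nat * nat) :=
  [&& x.2 < x.1, x.1 < rank C & degn C x.1 == degn C x.2].

(** Over F_2 the elementary matrix is its own inverse, so conjugation is written without an inverse;
    [slidable] carries the side conditions. *)
Definition slide (x : nat * nat) C : occ :=
  Occ (deg C) (elem (rank C) x.1 x.2 *m bd C *m elem (rank C) x.1 x.2)%R.

Lemma slideK C x : slidable C x -> slide x (slide x C) = C.
Proof.
case: x => k l /and3P[/= hlk hk _].
have hl : l < rank C by lia.
have := @elemK (rank C) (Ordinal hk) (Ordinal hl) hlk; rewrite /= => E.
rewrite /slide /=; case: C hk hl E => n d b /= hk hl E; congr Occ.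
by rewrite !mulmxA E mul1mx -!mulmxA E mulmx1.
Qed.

Lemma slidable_slide C x y : slidable (slide x C) y = slidable C y.
Proof. by []. Qed.

Lemma degn_slide C x j : degn (slide x C) j = degn C j.
Proof. by []. Qed.

(** The chain map of a handleslide is invertible, so it forces the target boundary: the relation is
    the graph of a function. *)
Lemma handleslideP k l C D :
  handleslide k l C D <-> slidable C (k, l) /\ D = slide (k, l) C.
Proof.
split=> [[rCD /andP[hlk hk] hd []]|[/and3P[/= hlk hk /eqP hd] ->]].
  case: C D rCD hk hd => n d b [m e c] /= rCD; case: m / rCD in e c * => hk hd.
  have hl : l < n by lia.
  have := @elemK n (Ordinal hk) (Ordinal hl) hlk; rewrite /= => E.
  rewrite -[X in (b *m X)%R]/(elem n k l) => _ _ hP hE.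
  split; first by rewrite /slidable /= hlk hk hd eqxx.
  rewrite /slide /=; have -> : d = e.
    by apply: eq_from_tnth => a; apply: hP; rewrite mxE eqxx orTb.
  by apply: (congr1 (@Occ n e)); rewrite -mulmxA hE mulmxA E mul1mx.
have hl : l < rank C by lia.
have := @elemK (rank C) (Ordinal hk) (Ordinal hl) hlk; rewrite /= => E.
have U : elem (rank C) k l \in unitmx by case: (mulmx1_unit E).
split=> //; first by rewrite hlk hk.
split=> /=.
- by rewrite row_free_unit.
- by rewrite row_full_unit.
- move=> i j; rewrite mxE -!degn_ord.
  case: (@eqP _ (j : nat) i) => [->//|_] /=.
  case: (@eqP _ (i : nat) k) => [->|//].
  by case: (@eqP _ (j : nat) l) => [->|//].
- by rewrite -[matrix_of_fun _ _]/(elem (rank C) k l) !mulmxA E mul1mx.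
Qed.

Lemma incid_slide_gen C k l j i : slidable C (k, l) ->
  incid (slide (k, l) C) j i =
  incid C j i (+) ((j == k) && incid C l i) (+) ((i == l) && incid C j k)
    (+) [&& j == k, i == l & incid C l k].
Proof.
move=> /and3P[/= hlk hk _]; have hl : l < rank C by lia.
case hj : (j < rank C); last first.
  have hj' : rank C <= j by lia.
  have -> : (j == k) = false by lia.
  by rewrite !(@incid_ge _ j) ?hj' ?andbF.
case hi : (i < rank C); last first.
  have hi' : rank C <= i by lia.
  have -> : (i == l) = false by lia.
  by rewrite !(@incid_ge _ _ i) ?hi' ?orbT ?andbF.
have -> : incid (slide (k, l) C) j i =
  ((elem (rank C) k l *m bd C *m elem (rank C) k l) (Ordinal hj) (Ordinal hi) == 1)%R.
  exact: (@incid_ord (slide (k, l) C) (Ordinal hj) (Ordinal hi)).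
rewrite (@elem_delta (rank C) (Ordinal hk) (Ordinal hl)) //.
rewrite mulmxDl mul1mx !mulmxDr !mulmx1 mulmxDl.
rewrite !mxE !F2_eq1D.
have -> : (\sum_j0 delta_mx (Ordinal hk) (Ordinal hl) (Ordinal hj) j0 * bd C j0 (Ordinal hi) =
   (j == k)%:R * bd C (Ordinal hl) (Ordinal hi) :> 'F_2)%R.
  rewrite (bigD1 (Ordinal hl)) //= big1 ?addr0; last first.
    by move=> m hm; rewrite mxE (negbTE hm) andbF mul0r.
  by rewrite mxE eqxx andbT.
have S2 (a : 'I_(rank C)) (X : 'M['F_2]_(rank C)) : (\sum_j0 X a j0 *
      delta_mx (Ordinal hk) (Ordinal hl) j0 (Ordinal hi) =
   X a (Ordinal hk) * (i == l)%:R :> 'F_2)%R.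
  rewrite (bigD1 (Ordinal hk)) //= big1 ?addr0; last first.
    by move=> m hm; rewrite mxE (negbTE hm) mulr0.
  by rewrite mxE eqxx.
rewrite !S2 mxE.
rewrite (bigD1 (Ordinal hl)) //= big1 ?addr0; last first.
    by move=> m hm; rewrite mxE (negbTE hm) andbF mul0r.
rewrite mxE eqxx andbT !F2_eq1M !F2_eq1_nat -!incid_ord /=.
by do 4?case: (incid _ _ _); case: (_ == _); case: (_ == _).
Qed.

(** Of the four terms of [(1 + N) d (1 + N)], with [N] a matrix unit, the last is an entry above the
    diagonal, hence zero. *)
Lemma incid_slide C k l j i : is_occ C -> slidable C (k, l) ->
  incid (slide (k, l) C) j i =
  incid C j i (+) ((j == k) && incid C l i) (+) ((i == l) && incid C j k).
Proof.
move=> oC sC; rewrite incid_slide_gen //.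
have /and3P[/= hlk _ _] := sC.
by rewrite (@occ_incid_ge _ l k) ?(ltnW hlk) // !andbF addbF.
Qed.

Lemma is_occ_slide C x : is_occ C -> slidable C x -> is_occ (slide x C).
Proof.
case: x => k l oC sC; have /and3P[/= hlk hk /eqP hd] := sC.
have hl : l < rank C by lia.
have := @elemK (rank C) (Ordinal hk) (Ordinal hl) hlk; rewrite /= => E.
split.
  rewrite /= -!mulmxA (mulmxA (elem _ k l) (elem _ k l)) E mul1mx.
  by rewrite (mulmxA (bd C)) oC.1 mul0mx mulmx0.
move=> j i; rewrite F2_neq0 -(@incid_ord (slide (k, l) C)) -!degn_ord !degn_slide.
rewrite incid_slide // => h.
case h1 : (incid C j i); first by case: (occ_incid oC h1).
move: h; rewrite h1 /=.
case h2 : (_ && _).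
  by move: h2 => /andP[/eqP-> /(occ_incid oC)[]]; rewrite hd; split=> //; lia.
by case/andP=> /eqP-> /(occ_incid oC)[]; rewrite hd; split=> //; lia.
Qed.

(** * Interchanges and deaths in coordinates *)

Lemma transpK i : involutive (transp i).
Proof. by move=> j; rewrite /transp; do 4?case: ifP => //; lia. Qed.

Lemma ltn_transp i j n : i.+1 < n -> (transp i j < n) = (j < n).
Proof. by rewrite /transp; do 2?case: ifP => //; lia. Qed.

Lemma interchangeP i C D :
  Defs.interchange i C D <->
  [/\ rank C = rank D, i.+1 < rank C,
      forall j, degn D (transp i j) = degn C j
    & forall j m, incid D (transp i j) (transp i m) = incid C j m].
Proof.
case: (eqVneq (rank C) (rank D)) => [rCD|/eqP ne]; last first.
  by split=> [[/ne]|[/ne]].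
case: (ltnP i.+1 (rank C)) => [hi|ge]; last first.
  by split=> [[_ h _]|[_ h _ _]]; move: h; rewrite ?ltnNge ?ge.
case: C D rCD hi => n d b [m e c] /= rCD; case: m / rCD in e c * => hi.
pose so (a : 'I_n) : 'I_n := Ordinal (etrans (ltn_transp a hi) (ltn_ord a)).
have soK : involutive so by move=> a; apply/val_inj; rewrite /= transpK.
pose P : 'M['F_2]_n := (\matrix_(a, j) (j == transp i a :> nat)%:R)%R.
have PE a j : P a j = (j == so a)%:R%R by rewrite mxE.
have PM X a j : ((P *m X) a j = X (so a) j)%R.
  rewrite mxE (bigD1 (so a)) //= PE eqxx mul1r big1 ?addr0 // => x hx.
  by rewrite PE (negbTE hx) mul0r.
have MP (X : 'M_n) a j : ((X *m P) a (so j) = X a j)%R.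
  rewrite mxE (bigD1 j) //= PE eqxx mulr1 big1 ?addr0 // => x hx.
  by rewrite PE (inj_eq (inv_inj soK)) eq_sym (negbTE hx) mulr0.
split=> [[_ _ []]|[_ _ hd hf]].
  rewrite -[matrix_of_fun _ _]/P => _ _ hP hE; split=> //.
    move=> j; case hj : (j < n); last first.
      by rewrite (@degn_ge (Occ d b)) 1?(@degn_ge (Occ e c)) //= leqNgt ?(ltn_transp _ hi) hj.
    rewrite (@degn_ord (Occ d b) (Ordinal hj)) (@degn_ord (Occ e c) (so (Ordinal hj))).
    by apply/esym/hP; rewrite PE eqxx.
  move=> j k; case hj : (j < n); last first.
    by rewrite (@incid_ge (Occ d b)) 1?(@incid_ge (Occ e c)) //= leqNgt ?(ltn_transp _ hi) hj.
  case hk : (k < n); last first.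
    by rewrite (@incid_ge (Occ d b)) 1?(@incid_ge (Occ e c)) //= orbC leqNgt ?(ltn_transp _ hi) hk.
  rewrite (@incid_ord (Occ d b) (Ordinal hj) (Ordinal hk)).
  rewrite (@incid_ord (Occ e c) (so (Ordinal hj)) (so (Ordinal hk))) /=.
  have := congr1 (fun A : 'M_n => A (Ordinal hj) (so (Ordinal hk))) hE.
  by rewrite MP PM => ->.
have U : P \in unitmx.
  suff /mulmx1_unit[] : (P *m P = 1%:M)%R by [].
  by apply/matrixP => a j; rewrite PM PE soK mxE eq_sym.
split=> //; rewrite -[matrix_of_fun _ _]/P; split=> /=.
- by rewrite row_free_unit.
- by rewrite row_full_unit.
- move=> a j; rewrite PE; case: (@eqP _ j (so a)) => [->|//] _.
  have := hd a; rewrite (@degn_ord (Occ d b)).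
  by rewrite (@degn_ord (Occ e c) (so a)) => ->.
- apply/matrixP => a j; rewrite -[j]soK MP PM.
  rewrite (@bdE (Occ d b) a (so j)) (@bdE (Occ e c) (so a) (so (so j))).
  by rewrite -hf.
Qed.

(** Inverse to [cusp_shift i] off the two cusp strands. *)
Definition up i j := if j < i then j else j.+2.

Lemma cusp_shiftK i k : k <> i -> k <> i.+1 -> up i (cusp_shift i k) = k.
Proof. by rewrite /up /cusp_shift; case: (ltnP k i); case: ltnP => /=; lia. Qed.

Lemma upK i k : cusp_shift i (up i k) = k.
Proof. by rewrite /up /cusp_shift; case: (ltnP k i); case: ltnP => /=; lia. Qed.

Lemma up_neq i k : (up i k == i) = false /\ (up i k == i.+1) = false.
Proof. by rewrite /up; case: ltnP => /=; lia. Qed.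

Lemma up_inj i : injective (up i).
Proof. exact: can_inj (upK i). Qed.

Lemma up_lt i j k : (up i j < up i k) = (j < k).
Proof. by rewrite /up; case: (ltnP j i); case: (ltnP k i); lia. Qed.

Lemma up_ltn_rank i j n : i.+1 < n.+2 -> (up i j < n.+2) = (j < n).
Proof. by rewrite /up; case: (ltnP j i); lia. Qed.

Variant up_spec i m : Prop :=
  | UpFst of m = i | UpSnd of m = i.+1 | UpImage b of m = up i b.

Lemma upP i m : up_spec i m.
Proof.
case: (eqVneq m i) => [->|h1]; first exact: UpFst.
case: (eqVneq m i.+1) => [->|h2]; first exact: UpSnd.
by apply: (@UpImage _ _ (cusp_shift i m)); rewrite cusp_shiftK //; apply/eqP.
Qed.

Lemma gen_bdE C k (z : 'I_1) (m : 'I_(rank C)) :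
  ((gen C k *m bd C) z m = (incid C k m)%:R)%R.
Proof.
rewrite mxE; case hk : (k < rank C).
  rewrite (bigD1 (Ordinal hk)) //= mxE eqxx mul1r big1 ?addr0 ?bdE // => j hj.
  by rewrite mxE -[k]/(val (Ordinal hk)) val_eqE (negbTE hj) mul0r.
have -> : incid C k m = false by rewrite incid_ge // leqNgt hk.
rewrite big1 // => j _; rewrite mxE.
by case: (@eqP _ (j : nat) k) => [e|_]; rewrite ?mul0r //; have := ltn_ord j; rewrite e hk.
Qed.

Lemma sub_col_mxP r n (X : 'M['F_2]_(r, n)) (u v : 'rV_n) :
  (X <= col_mx u v)%MS <->
  exists s t : 'I_r -> 'F_2, forall a m, (X a m = s a * u 0 m + t a * v 0 m)%R.
Proof.
split.
  case/submxP => D ->; rewrite -[D]hsubmxK mul_row_col.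
  exists (fun a => lsubmx D a 0%R), (fun a => rsubmx D a 0%R) => a m.
  by rewrite !mxE !big_ord1 !mxE.
case=> s [t h]; apply/submxP.
exists (row_mx (\matrix_(a, _) s a)%R (\matrix_(a, _) t a)%R).
by rewrite mul_row_col; apply/matrixP => a m; rewrite h !mxE !big_ord1 !mxE.
Qed.

Section Death.
Variables (i : nat) (C B : occ).
Hypotheses (rCB : rank C = (rank B).+2) (hi : i.+1 < rank C).

Let J : 'M['F_2]_(rank B, rank C) :=
  (\matrix_(a < rank B, j < rank C) (j == (if (a < i)%N then a : nat else a.+2)%N :> nat)%:R)%R.

Let upo_subproof (a : 'I_(rank B)) : up i a < rank C.
Proof. by rewrite rCB up_ltn_rank -?rCB. Qed.

Let upo a : 'I_(rank C) := Ordinal (upo_subproof a).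

Let upo_inj : injective upo.
Proof. by move=> a b /(congr1 val) /up_inj /val_inj. Qed.

Let JE a j : (J a j = (j == upo a)%:R)%R.
Proof. by rewrite mxE. Qed.

Let JM p (Y : 'M['F_2]_(rank C, p)) a m : ((J *m Y) a m = Y (upo a) m)%R.
Proof.
rewrite mxE (bigD1 (upo a)) //= JE eqxx mul1r big1 ?addr0 // => x hx.
by rewrite JE (negbTE hx) mul0r.
Qed.

Let MJ p (X : 'M['F_2]_(p, rank B)) a b : ((X *m J) a (upo b) = X a b)%R.
Proof.
rewrite mxE (bigD1 b) //= JE eqxx mulr1 big1 ?addr0 // => x hx.
by rewrite JE (inj_eq upo_inj) eq_sym (negbTE hx) mulr0.
Qed.

Let MJ0 p (X : 'M['F_2]_(p, rank B)) a (m : 'I_(rank C)) :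
  (m == i :> nat) || (m == i.+1 :> nat) -> ((X *m J) a m = 0)%R.
Proof.
move=> h; rewrite mxE big1 // => x _; rewrite JE; case: eqP => [e|_]; last by rewrite mulr0.
by move: h; rewrite e /=; case: (up_neq i x) => -> ->.
Qed.

Let upoP (m : 'I_(rank C)) :
  (m == i :> nat) || (m == i.+1 :> nat) \/ exists b, m = upo b.
Proof.
case: (upP i m) => [->|->|b e]; rewrite ?eqxx ?orbT; try by left.
have hb : b < rank B by rewrite -(@up_ltn_rank i) -?rCB // -e.
by right; exists (Ordinal hb); apply/val_inj.
Qed.

Hypothesis oC : is_occ C.

(** In the quotient y_{i+1} is zero and, since d y_{i+1} contains y_i, the class of y_i equals the
    rest of d y_{i+1}. Substituting this for y_i in d y_j gives the correction term. *)
Lemma deathP :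
  death i C B <->
  [/\ incid C i.+1 i,
      forall j, degn B j = degn C (up i j)
    & forall j m, incid B j m =
        incid C (up i j) (up i m) (+) (incid C (up i j) i && incid C i.+1 (up i m))].
Proof.
have hi' : i < rank C by exact: ltnW.
have subE r n (X Y : 'M['F_2]_(r, n)) a m : ((X - Y) a m = X a m - Y a m)%R.
  by rewrite !mxE.
pose oi := Ordinal hi'; pose os := Ordinal hi.
have S1 (m : 'I_(rank C)) : (gen C i.+1 0 m = (m == i.+1 :> nat)%:R)%R by rewrite mxE.
have Bge j : (rank B <= j) -> rank C <= up i j.
  by move=> hj; rewrite leqNgt rCB up_ltn_rank -?rCB // -leqNgt.
have xx : incid C i.+1 i.+1 = false by rewrite occ_incid_ge.
split=> [[_ _ inc []]|[inc hd hf]].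
  rewrite -/J => dJ /sub_col_mxP[s [t E]] _ _; split=> //.
    move=> j; case hj : (j < rank B); last first.
      have hj' : rank B <= j by rewrite leqNgt hj.
    by rewrite (@degn_ge B) // (@degn_ge C) // Bge.
    rewrite (degn_ord (Ordinal hj)) (degn_ord (upo (Ordinal hj))).
    by apply: dJ; rewrite JE eqxx.
  move=> j m; case hj : (j < rank B); last first.
    have hj' : rank B <= j by rewrite leqNgt hj.
    have z x : incid C (up i j) x = false by rewrite incid_ge // (Bge j hj').
    by rewrite !z incid_ge // hj'.
  case hm : (m < rank B); last first.
    have hm' : rank B <= m by rewrite leqNgt hm.
    have z x : incid C x (up i m) = false by rewrite incid_ge // (Bge m hm') orbT.
    by rewrite !z andbF incid_ge // hm' orbT.
  (* Column i is missed by [J] and by y_{i+1}, so it reads off the coefficient [t] of d y_{i+1}; the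
     remaining columns then give the boundary formula. *)
  have E1 := E (Ordinal hj) oi.
  rewrite subE JM MJ0 ?eqxx // S1 gen_bdE inc /= (ltn_eqF (ltnSn i)) mulr0 !add0r mulr1 in E1.
  have E2 := E (Ordinal hj) (upo (Ordinal hm)).
  rewrite subE JM MJ S1 gen_bdE /= (up_neq i m).2 mulr0 add0r in E2.
  rewrite (incid_ord (Ordinal hj) (Ordinal hm)).
  rewrite -[bd B _ _](subrK (bd C (upo (Ordinal hj)) (upo (Ordinal hm)))) E2 F2_eq1D.
  have Et : (t (Ordinal hj) == 1%R) = incid C (up i j) i.
    by move: E1; rewrite (@bdE C) /= => <-; case: incid.
  by rewrite F2_eq1M Et F2_eq1_nat -incid_ord addbC.
split=> //; rewrite -/J; split.
- move=> a m; rewrite JE; case: (@eqP _ m (upo a)) => [->|//] _.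
  by rewrite -!degn_ord hd.
- apply/sub_col_mxP.
  exists (fun a => (incid C (up i a) i.+1)%:R%R), (fun a => (incid C (up i a) i)%:R%R) => a m.
  rewrite subE JM S1 gen_bdE.
  have N2 (x : 'F_2) : (- x = x)%R by apply/esym/eqP; rewrite -subr_eq0 opprK F2_addxx.
  rewrite N2.
  case: (upoP m) => [h|[b ->]].
    rewrite MJ0 // add0r bdE /=; case/orP: h => /eqP->.
      by rewrite (ltn_eqF (ltnSn i)) mulr0 add0r inc mulr1.
    by rewrite eqxx xx mulr1 mulr0 addr0.
  rewrite MJ !bdE /= (up_neq i b).2 mulr0 add0r hf.
  by apply/eqP; case: (incid _ (up i a) i); do 2?case: (incid _ _ _).
- move=> v /sub_col_mxP[s [t E]].
  have E1 := E 0%R oi.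
  rewrite MJ0 ?eqxx // S1 gen_bdE inc /= (ltn_eqF (ltnSn i)) mulr0 add0r mulr1 in E1.
  apply/rowP => b; rewrite mxE -MJ E -E1 mul0r addr0 S1 /= (up_neq i b).2.
  by rewrite mulr0.
(* Subtracting w_{i+1} times y_{i+1} and w_i times d y_{i+1} clears the two cusp coordinates of [w];
   what is left is the preimage. *)
- move=> w; exists (\row_b (w 0 (upo b) - w 0 oi * (incid C i.+1 (up i b))%:R))%R.
  apply/sub_col_mxP; exists (fun=> w 0%R os), (fun=> w 0%R oi) => a m.
  rewrite ord1 subE S1 gen_bdE.
  case: (upoP m) => [h|[b ->]].
    rewrite MJ0 // subr0; case/orP: h => /eqP h; rewrite h.
      rewrite (ltn_eqF (ltnSn i)) mulr0 add0r inc mulr1.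
      by congr (w _ _); apply/val_inj.
    rewrite eqxx xx mulr1 mulr0 addr0.
    by congr (w _ _); apply/val_inj.
  rewrite MJ mxE /= (up_neq i b).2 mulr0 add0r.
  by rewrite opprB addrC subrK.
Qed.

End Death.

Lemma deathE i C B : is_occ C -> death i C B <->
  [/\ rank C = (rank B).+2, i.+1 < rank C, incid C i.+1 i,
      forall j, degn B j = degn C (up i j)
    & forall j m, incid B j m =
        incid C (up i j) (up i m) (+) (incid C (up i j) i && incid C i.+1 (up i m))].
Proof.
move=> oC; split=> [h|[h1 h2 h3 h4 h5]].
  have [h1 h2 _ _] := h.
  by have [] := (deathP h1 h2 oC).1 h.
exact/(deathP h1 h2 oC).
Qed.

(** * Equivalence of tails *)

Ltac case_incid :=
  repeat match goal with |- context [incid ?C ?j ?i] => case: (incid C j i) end.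

(** Every complex is required to be valid and the front is left out, so that the condition splits at
    any concatenation. *)
Fixpoint vsteps C q : Prop :=
  if q is (e, D) :: q' then [/\ step e C D, is_occ D & vsteps D q'] else True.

Lemma final_cat C p q : final C (p ++ q) = final (final C p) q.
Proof. by rewrite /final map_cat last_cat. Qed.

Lemma vsteps_cat C p q : vsteps C (p ++ q) <-> vsteps C p /\ vsteps (final C p) q.
Proof.
elim: p C => [|[e D] p IH] C /=; first by split=> [|[]].
split=> [[h1 h2 /IH[h3 h4]]|[[h1 h2 h3] h4]]; first by split.
by split=> //; apply/IH.
Qed.

Lemma vsteps_final C q : is_occ C -> vsteps C q -> is_occ (final C q).
Proof. by elim: q C => [|[e D] q IH] C //= oC [_ oD /(IH _ oD)]. Qed.

(** [mcs_move] without the front and with the initial complex fixed; such moves can be performed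
    inside a longer tail. *)
Definition tail_move C (t t' : seq (event * occ)) : Prop :=
  [/\ vsteps C t, vsteps C t' & exists p q q' r,
     [/\ t = p ++ q ++ r, t' = p ++ q' ++ r,
         final (final C p) q = final (final C p) q'
       & local_move (final C p) (events q) (events q')]].

Definition tail_equiv C := clos_refl_sym_trans _ (tail_move C).

Lemma tail_equiv_refl C t : tail_equiv C t t.
Proof. exact: rst_refl. Qed.

Lemma tail_equiv_sym C t t' : tail_equiv C t t' -> tail_equiv C t' t.
Proof. exact: rst_sym. Qed.

Lemma tail_equiv_trans C t t' t'' :
  tail_equiv C t t' -> tail_equiv C t' t'' -> tail_equiv C t t''.
Proof. exact: rst_trans. Qed.

Lemma tail_equiv_final C t t' : tail_equiv C t t' -> final C t = final C t'.
Proof.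
elim=> {t t'} [t t' [_ _ [p [q [q' [r [-> -> e _]]]]]]|//|//|t1 t2 t3 _ -> _ -> //].
by rewrite !final_cat e.
Qed.

Lemma tail_equiv_vsteps C t t' : tail_equiv C t t' -> vsteps C t <-> vsteps C t'.
Proof.
by elim=> {t t'} [t t' [h1 h2 _]|//|t1 t2 _ h|t1 t2 t3 _ h1 _ h2]; tauto.
Qed.

Lemma tail_equiv_catl C p t t' :
  vsteps C p -> tail_equiv (final C p) t t' -> tail_equiv C (p ++ t) (p ++ t').
Proof.
move=> hp.
elim=> {t t'} [t t' [h1 h2 [p' [q [q' [r [e1 e2 e h]]]]]]|t|t1 t2 _ h|t1 t2 t3 _ h1 _ h2].
- apply: rst_step; split; try by apply/vsteps_cat.
  exists (p ++ p'), q, q', r; rewrite e1 e2 !catA.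
  by split=> //; rewrite !final_cat.
- exact: tail_equiv_refl.
- exact: tail_equiv_sym.
- exact: tail_equiv_trans h1 h2.
Qed.

Lemma tail_equiv_catr C r t t' :
  vsteps (final C t) r -> tail_equiv C t t' -> tail_equiv C (t ++ r) (t' ++ r).
Proof.
move=> hr E; elim: E hr => {t t'}
  [t t' [h1 h2 [p' [q [q' [r' [e1 e2 e h]]]]]]|t|t1 t2 e h|t1 t2 t3 e1 h1 e2 h2] hr.
- apply: rst_step; split; first by apply/vsteps_cat.
    apply/vsteps_cat; split=> //; move: hr; rewrite e1 e2.
    by rewrite !final_cat e.
  by exists p', q, q', (r' ++ r); rewrite e1 e2 !catA.
- exact: tail_equiv_refl.
- by apply/tail_equiv_sym/h; rewrite (tail_equiv_final e).
- apply: tail_equiv_trans (h1 hr) (h2 _).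
  by rewrite -(tail_equiv_final e1).
Qed.

Lemma tail_equiv_move C q q' : vsteps C q -> vsteps C q' ->
  final C q = final C q' -> local_move C (events q) (events q') ->
  tail_equiv C q q'.
Proof.
move=> h1 h2 h3 h4; apply: rst_step; split=> //.
by exists [::], q, q', [::]; rewrite /= !cats0.
Qed.

(** * Words of handleslides *)

Definition word C (V : seq (nat * nat)) := all (slidable C) V.

(** Only the pairs are data; the complexes are recomputed from [C], so rewriting a word needs no
    bookkeeping of complexes. *)
Fixpoint run C (V : seq (nat * nat)) : seq (event * occ) :=
  if V is x :: V' then (Hs x.1 x.2, slide x C) :: run (slide x C) V' else [::].

Definition slides C (V : seq (nat * nat)) : occ := foldl (fun D x => slide x D) C V.

Lemma slides_cat C V W : slides C (V ++ W) = slides (slides C V) W.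
Proof. exact: foldl_cat. Qed.

Lemma final_run C V : final C (run C V) = slides C V.
Proof. by elim: V C => //= x V IH C; rewrite -IH. Qed.

Lemma run_cat C V W : run C (V ++ W) = run C V ++ run (slides C V) W.
Proof. by elim: V C => //= x V IH C; rewrite IH. Qed.

Lemma events_run C V : events (run C V) = [seq Hs x.1 x.2 | x <- V].
Proof. by elim: V C => //= x V IH C; rewrite -(IH (slide x C)). Qed.

Lemma rank_slides C V : rank (slides C V) = rank C.
Proof. by elim: V C => //= x V IH C; rewrite IH. Qed.

Lemma degn_slides C V k : degn (slides C V) k = degn C k.
Proof. by elim: V C => //= x V IH C; rewrite IH. Qed.

Lemma slidable_slides C V x : slidable (slides C V) x = slidable C x.
Proof. by rewrite /slidable rank_slides !degn_slides. Qed.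

Lemma word_slides C V W : word (slides C V) W = word C W.
Proof. by apply: eq_all => x; rewrite slidable_slides. Qed.

Lemma word_cat C V W : word C (V ++ W) = word C V && word C W.
Proof. exact: all_cat. Qed.

Lemma is_occ_slides C V : is_occ C -> word C V -> is_occ (slides C V).
Proof.
elim: V C => //= x V IH C oC /andP[hx hV]; apply: IH => //.
exact: is_occ_slide.
Qed.

Lemma vsteps_run C V : is_occ C -> word C V -> vsteps C (run C V).
Proof.
elim: V C => //= -[k l] V IH C oC /andP[hx hV]; split.
- exact/handleslideP.
- exact: is_occ_slide.
- by apply: IH => //; apply: is_occ_slide.
Qed.

Lemma slides_rev C V : word C V -> slides (slides C V) (rev V) = C.
Proof.
elim: V C => //= x V IH C /andP[hx hV].
by rewrite rev_cons -cats1 slides_cat IH //= slideK.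
Qed.

Definition word_equiv C V W : Prop :=
  [/\ word C V, word C W & tail_equiv C (run C V) (run C W)].

Lemma word_equiv_refl C V : word C V -> word_equiv C V V.
Proof. by split=> //; apply: tail_equiv_refl. Qed.

Lemma word_equiv_sym C V W : word_equiv C V W -> word_equiv C W V.
Proof. by case=> *; split=> //; apply: tail_equiv_sym. Qed.

Lemma word_equiv_trans C V W U :
  word_equiv C V W -> word_equiv C W U -> word_equiv C V U.
Proof. by case=> ? ? h [? ? ?]; split=> //; apply: tail_equiv_trans h _. Qed.

Lemma word_equiv_slides C V W : word_equiv C V W -> slides C V = slides C W.
Proof. by case=> _ _ /tail_equiv_final; rewrite !final_run. Qed.

Lemma word_equiv_ctx C P V W S : is_occ C -> word C P -> word C S ->
  word_equiv (slides C P) V W -> word_equiv C (P ++ V ++ S) (P ++ W ++ S).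
Proof.
move=> oC hP hS E; have eVW := word_equiv_slides E.
have oP := is_occ_slides oC hP.
case: E; rewrite !word_slides => hV hW E; split; rewrite ?word_cat ?hP ?hV ?hW ?hS //.
rewrite !run_cat; apply: tail_equiv_catl; first exact: vsteps_run.
rewrite final_run -eVW; apply: tail_equiv_catr => //.
rewrite final_run; apply: vsteps_run; rewrite ?word_slides //.
by apply: is_occ_slides; rewrite ?word_slides.
Qed.

Lemma word_equiv_catl C P V W : is_occ C -> word C P ->
  word_equiv (slides C P) V W -> word_equiv C (P ++ V) (P ++ W).
Proof.
by move=> oC hP /(@word_equiv_ctx C P V W [::] oC hP isT); rewrite !cats0.
Qed.

Lemma word_equiv_catr C S V W : is_occ C -> word C S ->
  word_equiv C V W -> word_equiv C (V ++ S) (W ++ S).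
Proof. by move=> oC hS; apply: (@word_equiv_ctx C [::] V W S). Qed.

Lemma word_equiv_move C V W : is_occ C -> word C V -> word C W ->
  slides C V = slides C W ->
  local_move C [seq Hs x.1 x.2 | x <- V] [seq Hs x.1 x.2 | x <- W] ->
  word_equiv C V W.
Proof.
move=> oC hV hW e m; split=> //; apply: tail_equiv_move.
- exact: vsteps_run.
- exact: vsteps_run.
- by rewrite !final_run.
- by rewrite !events_run.
Qed.

Lemma word_cancel C x : is_occ C -> slidable C x -> word_equiv C [:: x; x] [::].
Proof.
move=> oC sx; apply: word_equiv_move => [//||//||]; rewrite /= ?sx ?slideK //.
exact: MoveCancel.
Qed.

Definition commuting (x y : nat * nat) := (x.1 != y.2) && (y.1 != x.2).

Lemma word_commute C x y : is_occ C -> slidable C x -> slidable C y ->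
  commuting x y -> word_equiv C [:: x; y] [:: y; x].
Proof.
case: x y => [k l] [k' l'] oC sx sy /andP[/= h1 h2].
apply: word_equiv_move => [//|||/=|/=]; rewrite /= ?sx ?sy; last first.
- by apply: MoveCommute; apply/eqP.
- apply: occ_ext => [//|//|j i].
  have ox := is_occ_slide oC sx; have oy := is_occ_slide oC sy.
  rewrite !incid_slide // (eq_sym l' k) (eq_sym l k') (negbTE h1) (negbTE h2).
  case: (j == k); case: (j == k'); case: (i == l); case: (i == l') => //=;
  by case_incid.
- by [].
- by [].
Qed.

Lemma word_triangle C a b c : is_occ C -> slidable C (a, b) -> slidable C (b, c) ->
  word_equiv C [:: (a, b); (b, c)] [:: (b, c); (a, c); (a, b)].
Proof.
move=> oC s1 s2.
have /and3P[/= ba ra /eqP dab] := s1; have /and3P[/= cb rb /eqP dbc] := s2.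
have s3 : slidable C (a, c) by rewrite /slidable /= dab dbc eqxx ra (ltn_trans cb ba).
apply: word_equiv_move => [//||||/=]; rewrite /= ?s1 ?s2 ?s3 //; last exact: MoveTriangle.
apply: occ_ext => [//|//|j i].
have o1 := is_occ_slide oC s1; have o2 := is_occ_slide oC s2.
have o3 : is_occ (slide (a, c) (slide (b, c) C)) by apply: is_occ_slide.
have n1 : (a == b) = false by lia.
have n2 : (a == c) = false by lia.
have n3 : (b == c) = false by lia.
have n4 : (b == a) = false by lia.
have n5 : (c == a) = false by lia.
have n6 : (c == b) = false by lia.
rewrite !incid_slide // ?n1 ?n2 ?n3 ?n4 ?n5 ?n6 ?eqxx /=.
have f1 : incid C b a = false by apply: occ_incid_ge => //; lia.
have f2 : incid C c a = false by apply: occ_incid_ge => //; lia.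
have f3 : incid C c b = false by apply: occ_incid_ge => //; lia.
have f4 : incid C b b = false by apply: occ_incid_ge => //; lia.
rewrite f1 f2 f3 f4 ?andbF ?addbF.
case: (j == a); case: (j == b); case: (i == b); case: (i == c) => //=;
by case_incid.
Qed.

(** All slides share the upper strand k and each v lies below k, so none of the rows and columns
    being added is changed by an earlier slide; the effects add up. *)
Lemma incid_slides_row C k vs j i : is_occ C -> uniq vs ->
  word C [seq (k, v) | v <- vs] ->
  incid (slides C [seq (k, v) | v <- vs]) j i =
  incid C j i (+) ((j == k) && \big[addb/false]_(v <- vs) incid C v i)
    (+) ((i \in vs) && incid C j k).
Proof.
elim: vs C => [|v vs IH] C oC /=; first by rewrite big_nil andbF !addbF.
case/andP=> nv uv /andP[sv hvs]; rewrite IH //; last exact: is_occ_slide.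
have /and3P[/= vk _ _] := sv.
rewrite big_cons !incid_slide // inE.
rewrite (@occ_incid_ge C v k) ?(ltnW vk) // (gtn_eqF vk) !andbF /= !addbF.
have -> : \big[addb/false]_(v0 <- vs) incid (slide (k, v) C) v0 i =
          \big[addb/false]_(v0 <- vs) incid C v0 i.
  apply: eq_big_seq => w hw.
  have /and3P[/= wk _ _] := allP hvs _ (map_f (fun v => (k, v)) hw).
  by rewrite incid_slide // (ltn_eqF wk) (@occ_incid_ge C w k) ?(ltnW wk) // andbF !addbF.
case: (eqVneq i v) => [->|_]; first by rewrite (negbTE nv) /=;
  case: (j == k); case_incid; case: (\big[_/_]_(_ <- _) _).
by case: (j == k); case: (i \in vs); case_incid; case: (\big[_/_]_(_ <- _) _).
Qed.

Lemma incid_slides_col C l us j i : is_occ C -> uniq us ->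
  word C [seq (u, l) | u <- us] ->
  incid (slides C [seq (u, l) | u <- us]) j i =
  incid C j i (+) ((j \in us) && incid C l i)
    (+) ((i == l) && \big[addb/false]_(u <- us) incid C j u).
Proof.
elim: us C => [|u us IH] C oC /=; first by rewrite big_nil andbF !addbF.
case/andP=> nu uu /andP[su hus]; rewrite IH //; last exact: is_occ_slide.
have /and3P[/= lu _ _] := su.
rewrite big_cons !incid_slide // inE.
rewrite (@occ_incid_ge C l u) ?(ltnW lu) // (ltn_eqF lu) !andbF /= !addbF.
have -> : \big[addb/false]_(v <- us) incid (slide (u, l) C) j v =
          \big[addb/false]_(v <- us) incid C j v.
  apply: eq_big_seq => w hw.
  have /and3P[/= lw _ _] := allP hus _ (map_f (fun v => (v, l)) hw).
  by rewrite incid_slide // (gtn_eqF lw) (@occ_incid_ge C l w) ?(ltnW lw) // andbF !addbF.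
case: (eqVneq j u) => [->|_]; first by rewrite (negbTE nu) /=;
  case: (i == l); case_incid; case: (\big[_/_]_(_ <- _) _).
by case: (i == l); case: (j \in us); case_incid; case: (\big[_/_]_(_ <- _) _).
Qed.

(** The marks of [MoveBoundary]: the chain map 1 + dH + Hd, for the map H that
    sends y_k to y_l and the other generators to 0. *)
Definition homotopy_word C k l :=
  [seq (k, v) | v <- [seq v <- iota 0 (rank C) | incid C l v]] ++
  [seq (u, l) | u <- [seq u <- iota 0 (rank C) | incid C u k]].

(** The slides of the first half and those of the second each contribute the product of
    [incid C j k] and [incid C l i] to entry (j, i), so these cancel; the remaining sums vanish
    because the boundary squares to zero. *)
Lemma word_homotopy C k l : is_occ C -> l < k -> k < rank C ->
  degn C l = (degn C k + 1)%R -> word_equiv C [::] (homotopy_word C k l).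
Proof.
move=> oC lk kr dlk.
have w1 : word C [seq (k, v) | v <- [seq v <- iota 0 (rank C) | incid C l v]].
  apply/allP => x /mapP[v]; rewrite mem_filter mem_iota => /andP[hv _] ->.
  have [vl dv] := occ_incid oC hv.
  rewrite /slidable /= kr (ltn_trans vl lk) /=; apply/eqP.
  by apply: (addIr (1%R : int)); rewrite -dlk.
have w2 : word C [seq (u, l) | u <- [seq u <- iota 0 (rank C) | incid C u k]].
  apply/allP => x /mapP[u]; rewrite mem_filter mem_iota => /andP[hu /andP[_ ru]] ->.
  have [uk du] := occ_incid oC hu.
  rewrite /slidable /= (ltn_trans lk uk) [_ < rank C]ru /=; apply/eqP.
  by rewrite du dlk.
apply: word_equiv_move => [//|//||/=|/=]; first by rewrite word_cat w1.
  rewrite slides_cat; apply: occ_ext => [|m|j i]; rewrite ?rank_slides ?degn_slides //.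
  rewrite incid_slides_col ?word_slides //; last 2 first.
  - exact: is_occ_slides.
  - by rewrite filter_uniq ?iota_uniq.
  rewrite !incid_slides_row ?filter_uniq ?iota_uniq // !mem_filter !mem_iota /=.
  have z1 m : \big[addb/false]_(v <- [seq v <- iota 0 (rank C) | incid C l v]) incid C v m = false.
    by rewrite big_filter occ_sq.
  rewrite !z1 !andbF !addbF.
  rewrite (@occ_incid_ge C l k) ?(ltnW lk) // andbF addbF.
  have -> : \big[addb/false]_(u <- [seq u <- iota 0 (rank C) | incid C u k])
     incid (slides C [seq (k, v) | v <- [seq v <- iota 0 (rank C) | incid C l v]]) j u = false.
    rewrite big_filter -[RHS](@occ_sq C j k oC).
    rewrite big_mkcond [RHS]big_mkcond; apply: eq_big_seq => u hu.
    case hk : (incid C u k); last by rewrite if_same.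
    rewrite incid_slides_row ?filter_uniq ?iota_uniq // z1 andbF addbF mem_filter.
    have [uk _] := occ_incid oC hk.
    by rewrite (@occ_incid_ge C l u) ?(ltnW (ltn_trans lk uk)) // addbF; case: incid.
  rewrite andbF addbF -[_ && (i < _)]/(_ && _).
  have -> : incid C l i && (i < rank C) = incid C l i.
    by case h : (incid C l i) => //=; have /andP[_ ->] := incid_rank h.
  have -> : incid C j k && (j < rank C) = incid C j k.
    by case h : (incid C j k) => //=; have /andP[-> _] := incid_rank h.
  by case_incid.
rewrite map_cat -!map_comp; exact: MoveBoundary.
Qed.

(** * Passing marks through singularities *)

(** Either the marks commute, or a triangle relation adds one mark, [h_{a,i}] or [h_{i+1,b}]. None
    of the marks in [W] is [h_{i+1,i}], which lets the extraction run by induction on the word. *)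
Lemma word_commute_swap C i x : is_occ C -> slidable C (i.+1, i) -> slidable C x ->
  x != (i.+1, i) ->
  exists2 W, (i.+1, i) \notin W & word_equiv C [:: x; (i.+1, i)] ((i.+1, i) :: W).
Proof.
move=> oC ss; case: x => a b sx; rewrite xpair_eqE => nx.
have /and3P[/= ba _ dab] := sx; have /and3P[/= _ ri dii] := ss.
case: (eqVneq b i.+1) => [eb|nb].
  subst b; exists [:: (a, i); (a, i.+1)]; last exact: word_triangle.
  by rewrite !inE !xpair_eqE; lia.
case: (eqVneq a i) => [ea|na]; last first.
  exists [:: (a, b)]; first by rewrite inE xpair_eqE; lia.
  by apply: word_commute => //; rewrite /commuting /=; lia.
subst a; exists [:: (i.+1, b); (i, b)]; first by rewrite !inE !xpair_eqE; lia.
have sib : slidable C (i.+1, b).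
  by rewrite /slidable /= (eqP dii) dab ri !andbT; lia.
(* For [h_{i,b}] the triangle relation has its factors in the other order; started from the
   right-hand side it produces a second [h_{i+1,b}], which cancels. *)
apply: word_equiv_sym.
apply: (@word_equiv_trans _ _ ([:: (i.+1, b); (i.+1, i)] ++ [:: (i, b)])).
  apply: (@word_equiv_catr _ _ [:: _; _] [:: _; _]) => //=; first by rewrite sx.
  by apply: word_commute => //; rewrite /commuting /=; lia.
apply: (@word_equiv_trans _ _ ([:: (i.+1, b)] ++ [:: (i, b); (i.+1, b); (i.+1, i)])).
  apply: (@word_equiv_catl _ [:: (i.+1, b)] [:: _; _]) => //=; first by rewrite sib.
  by apply: word_triangle => //; apply: is_occ_slide.
apply: (@word_equiv_trans _ _ ([:: (i, b); (i.+1, b)] ++ [:: (i.+1, b); (i.+1, i)])).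
  apply: (@word_equiv_catr _ _ [:: (i.+1, b); (i, b)]) => //=; first by rewrite sib ss.
  by apply: word_commute => //; rewrite /commuting /=; lia.
apply: (@word_equiv_ctx _ [:: (i, b)] [:: (i.+1, b); (i.+1, b)] [::] [:: (i.+1, i)]) => //=.
- by rewrite sx.
- by rewrite ss.
- by apply: word_cancel; [apply: is_occ_slide | rewrite slidable_slide].
Qed.

(** In the construction [b] is the parity of the occurrences of [h_{i+1,i}]: two copies that meet at
    the front cancel. *)
Lemma word_extract_swap C i V : is_occ C -> word C V ->
  exists b : bool, exists2 V', (i.+1, i) \notin V' &
    word_equiv C V (if b then (i.+1, i) :: V' else V').
Proof.
elim: V C => [|x V IH] C oC.
  by exists false, [::] => //; apply: word_equiv_refl.
case/andP=> sx wV; have ox := is_occ_slide oC sx.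
have [b [V' nV' E]] := IH _ ox wV.
have E1 := @word_equiv_catl _ [:: x] _ _ oC (introT andP (conj sx isT)) E.
have wV' : word C V' by case: E => _ + _; case: (b) => //= /andP[].
case: (eqVneq x (i.+1, i)) => [ex|nx].
  subst x; exists (~~ b), V' => //; case: b E E1 => //= E E1.
  apply: word_equiv_trans E1 _.
  by apply: (@word_equiv_catr _ _ [:: _; _] [::]) => //; apply: word_cancel.
case: b E E1 => /= E E1; last first.
  by exists false, (x :: V') => //; rewrite inE negb_or eq_sym nx.
have /andP[ss _] : word C ((i.+1, i) :: V') by case: E.
have [W nW EW] := word_commute_swap oC ss sx nx.
exists true, (W ++ V'); first by rewrite mem_cat negb_or nW.
by apply: word_equiv_trans E1 _; apply: (@word_equiv_catr _ _ [:: _; _] (_ :: _)).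
Qed.

(** The mark nearest to [e] passes first, and the complex after [e] is replaced each time. The marks
    produced lie beyond [e], so nothing is asked of them in terms of [P]. *)
Lemma pass_word e (P : pred (nat * nat)) :
  (forall C D x, is_occ C -> is_occ D -> slidable C x -> P x -> step e (slide x C) D ->
     exists D' W, [/\ step e C D', is_occ D', word D' W &
       tail_equiv C [:: (Hs x.1 x.2, slide x C); (e, D)] ((e, D') :: run D' W)]) ->
  forall V C D, is_occ C -> is_occ D -> word C V -> all P V -> step e (slides C V) D ->
     exists D' W, [/\ step e C D', is_occ D', word D' W &
       tail_equiv C (run C V ++ [:: (e, D)]) ((e, D') :: run D' W)].
Proof.
move=> one; elim=> [|x V IH] C D oC oD /=.
  by move=> _ _ h; exists D, [::]; split=> //; apply: tail_equiv_refl.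
case/andP=> sx wV /andP[px pV] h.
have ox := is_occ_slide oC sx.
have [D1 [W1 [h1 o1 w1 E1]]] := IH _ _ ox oD wV pV h.
have [D2 [W2 [h2 o2 w2 E2]]] := one _ _ _ oC o1 sx px h1.
have e2 : slides D2 W2 = D1 by have := tail_equiv_final E2; rewrite /final /= -/(final D2 _) final_run.
exists D2, (W2 ++ W1); split=> //.
  by rewrite word_cat w2 -(word_slides D2 W2) e2.
have c1 : vsteps C [:: (Hs x.1 x.2, slide x C)].
  by have := @vsteps_run C [:: x] oC; rewrite /word /= sx => /(_ isT).
apply: tail_equiv_trans (tail_equiv_catl c1 E1) _.
rewrite run_cat e2.
apply: (@tail_equiv_catr _ (run D1 W1) [:: _; _] _ _ E2).
exact: vsteps_run.
Qed.

Lemma interchange_slide C D i x : is_occ C -> is_occ D -> slidable C x ->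
  x != (i.+1, i) -> Defs.interchange i (slide x C) D ->
  slidable D (transp i x.1, transp i x.2) /\
  Defs.interchange i C (slide (transp i x.1, transp i x.2) D).
Proof.
case: x => k l oC oD sx; rewrite xpair_eqE => nx /interchangeP[/= rCD hi hd hf].
have /and3P[/= lk rk dkl] := sx.
have sD : slidable D (transp i k, transp i l).
  rewrite /slidable /= !hd !degn_slide dkl andbT -rCD (ltn_transp _ hi) rk andbT.
  by rewrite /transp; do 4?case: ifP; lia.
split=> //; apply/interchangeP; split=> // j m.
rewrite incid_slide // !hf !(inj_eq (inv_inj (transpK i))).
by rewrite -[in RHS](slideK sx) [in RHS]incid_slide //; apply: is_occ_slide.
Qed.

Lemma pass_crossing i C D x : is_occ C -> is_occ D -> slidable C x ->
  x != (i.+1, i) -> step (Cr i) (slide x C) D ->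
  exists D' W, [/\ step (Cr i) C D', is_occ D', word D' W &
    tail_equiv C [:: (Hs x.1 x.2, slide x C); (Cr i, D)] ((Cr i, D') :: run D' W)].
Proof.
move=> oC oD sx nx h; have [sD h'] := interchange_slide oC oD sx nx h.
set y := (transp i x.1, transp i x.2) in sD h'.
have oD' := is_occ_slide oD sD.
exists (slide y D), [:: y]; split=> //; first by rewrite /word /= slidable_slide sD.
have ox := is_occ_slide oC sx.
apply: tail_equiv_move.
- by split=> //; case: (x) sx => k l sx; apply/handleslideP.
- split; [exact: h' | exact: oD' |].
  by apply: vsteps_run; [exact: oD' | rewrite /word /= slidable_slide sD].
- by rewrite /final /= slideK.
- rewrite /events /=; apply: MoveCrossing.
  by case: (x) nx => k l /eqP.
Qed.

Lemma death_slide i C B k l : is_occ C -> is_occ B -> slidable C (k, l) ->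
  k <> i -> k <> i.+1 -> l <> i -> l <> i.+1 ->
  death i (slide (k, l) C) B ->
  slidable B (cusp_shift i k, cusp_shift i l) /\
  death i C (slide (cusp_shift i k, cusp_shift i l) B).
Proof.
move=> oC oB sx k0 k1 l0 l1; have ox := is_occ_slide oC sx.
move/(deathE _ _ ox) => [/= rCB hi inc hd hf].
have /and3P[/= lk rk dkl] := sx.
have Ek := cusp_shiftK k0 k1; have El := cusp_shiftK l0 l1.
set k' := cusp_shift i k in Ek *; set l' := cusp_shift i l in El *.
have sB : slidable B (k', l').
  rewrite /slidable /= !hd Ek El !degn_slide dkl andbT -(up_lt i) Ek El lk /=.
  by rewrite -(@up_ltn_rank i) -?rCB // Ek.
have inv j m : incid C j m = incid (slide (k, l) C) j m (+)
    ((j == k) && incid (slide (k, l) C) l m) (+) ((m == l) && incid (slide (k, l) C) j k).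
  by rewrite -[in LHS](slideK sx) incid_slide.
have k1' : (i.+1 == k) = false by apply/eqP => e; apply: k1.
have l0' : (i == l) = false by apply/eqP => e; apply: l0.
split=> //; apply/(deathE _ _ oC).
have E k2 l2 : (up i k2 == up i l2) = (k2 == l2) by rewrite (inj_eq (@up_inj i)).
split=> // [|j m].
- by rewrite inv k1' l0' !addbF.
- rewrite incid_slide // !hf Ek El -(E j) -(E m) Ek El.
  rewrite !inv k1' l0' /= !addbF.
  set F := incid (slide (k, l) C).
  (* Two corrections meet only in the entry (k, l); their product would need i < l and k < i+1,
     against l < k. *)
  have z : F l i && F i.+1 k = false.
    by apply/negP => /andP[/(occ_incid ox)[u _] /(occ_incid ox)[v _]]; lia.
  move: z; case: (up i j == k); case: (up i m == l); rewrite /F; case_incid => //.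
Qed.

(** The mark adds y_{i+1}, which is zero in the quotient, to y_k. *)
Lemma death_slide_above i C B k : is_occ C -> slidable C (k, i.+1) ->
  death i (slide (k, i.+1) C) B -> death i C B.
Proof.
move=> oC sx; have ox := is_occ_slide oC sx.
move/(deathE _ _ ox) => [/= rCB hi inc hd hf].
have /and3P[/= lk rk dkl] := sx.
have inv j m : incid C j m = incid (slide (k, i.+1) C) j m (+)
    ((j == k) && incid (slide (k, i.+1) C) i.+1 m) (+)
    ((m == i.+1) && incid (slide (k, i.+1) C) j k).
  by rewrite -[in LHS](slideK sx) incid_slide.
apply/(deathE _ _ oC); split=> // [|j m].
  by rewrite inv inc (ltn_eqF lk) (ltn_eqF (ltnSn i)).
rewrite hf !inv (up_neq i m).2 (ltn_eqF lk) (ltn_eqF (ltnSn i)) inc.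
by case: (up i j == k); case_incid.
Qed.

(** The mark changes y_i only, and the basis of the quotient consists of the classes of generators
    other than y_i and y_{i+1}. *)
Lemma death_slide_below i C B l : is_occ C -> slidable C (i, l) ->
  death i (slide (i, l) C) B -> death i C B.
Proof.
move=> oC sx; have ox := is_occ_slide oC sx.
move/(deathE _ _ ox) => [/= rCB hi inc hd hf].
have /and3P[/= lk rk dkl] := sx.
have inv j m : incid C j m = incid (slide (i, l) C) j m (+)
    ((j == i) && incid (slide (i, l) C) l m) (+)
    ((m == l) && incid (slide (i, l) C) j i).
  by rewrite -[in LHS](slideK sx) incid_slide.
apply/(deathE _ _ oC); split=> // [|j m].
  by rewrite inv inc (gtn_eqF (ltnSn i)) (gtn_eqF lk).
rewrite hf !inv (up_neq i j).1 (gtn_eqF lk) (gtn_eqF (ltnSn i)) inc.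
by case: (up i m == l); case_incid.
Qed.

(** Marks violating this condition can neither pass a right cusp of strands i
    and i + 1 nor be absorbed by it. *)
Definition avoids_cusp i (x : nat * nat) := (x.1 != i.+1) && (x.2 != i).

Lemma pass_right_cusp i C D x : is_occ C -> is_occ D -> slidable C x ->
  avoids_cusp i x -> step (Rc i) (slide x C) D ->
  exists D' W, [/\ step (Rc i) C D', is_occ D', word D' W &
    tail_equiv C [:: (Hs x.1 x.2, slide x C); (Rc i, D)] ((Rc i, D') :: run D' W)].
Proof.
case: x => k l oC oD sx /andP[/= k1 l0] h.
have /and3P[/= lk _ _] := sx.
have ox := is_occ_slide oC sx.
have v1 : vsteps C [:: (Hs k l, slide (k, l) C); (Rc i, D)].
  by split=> //; apply/handleslideP.
case: (eqVneq l i.+1) => [el|l1].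
  have h' : death i C D by subst l; apply: death_slide_above h.
  exists D, [::]; split=> //; apply: tail_equiv_move => //.
  by subst l; apply: MoveRightCuspAbove.
case: (eqVneq k i) => [ek|k0].
  have h' : death i C D by subst k; apply: death_slide_below h.
  exists D, [::]; split=> //; apply: tail_equiv_move => //.
  by subst k; apply: MoveRightCuspBelow.
have [sD h'] := death_slide oC oD sx (elimN eqP k0) (elimN eqP k1) (elimN eqP l0) (elimN eqP l1) h.
set y := (cusp_shift i k, cusp_shift i l) in sD h'.
have oD' := is_occ_slide oD sD.
exists (slide y D), [:: y]; split=> //; first by rewrite /word /= slidable_slide sD.
apply: tail_equiv_move; first exact: v1.
- split; [exact: h' | exact: oD' |].
  by apply: vsteps_run; [exact: oD' | rewrite /word /= slidable_slide sD].
- by rewrite /final /= slideK.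
- by apply: MoveRightCusp; apply/eqP.
Qed.

(** Both end strands exist before the cusp, so [death_slide], read from the right complex to the
    left one, moves any mark. *)
Lemma pass_left_cusp i C D x : is_occ C -> is_occ D -> slidable C x ->
  true -> step (Lc i) (slide x C) D ->
  exists D' W, [/\ step (Lc i) C D', is_occ D', word D' W &
    tail_equiv C [:: (Hs x.1 x.2, slide x C); (Lc i, D)] ((Lc i, D') :: run D' W)].
Proof.
case: x => k l oC oD sx _ h.
have /and3P[/= lk rk dkl] := sx.
have ox := is_occ_slide oC sx.
have [rD hi _ hd _] := (deathE i _ oD).1 h.
pose y := (up i k, up i l).
have sy : slidable D y.
  rewrite /slidable /= -!hd !degn_slide dkl andbT up_lt lk rD up_ltn_rank //.
  by rewrite -rD.
have oD' := is_occ_slide oD sy.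
have [k0 k1] := up_neq i k; have [l0 l1] := up_neq i l.
have sy' : slidable (slide y D) y by rewrite slidable_slide.
have [] := @death_slide i (slide y D) (slide (k, l) C) (up i k) (up i l) oD' ox sy'
  (elimF eqP k0) (elimF eqP k1) (elimF eqP l0) (elimF eqP l1).
  by rewrite -/y slideK.
rewrite !upK => _; rewrite slideK // => h'.
exists (slide y D), [:: y]; split=> //; first by rewrite /word /= sy'.
apply: tail_equiv_move.
- by split=> //; apply/handleslideP.
- split; [exact: h' | exact: oD' |].
  by apply: vsteps_run; [exact: oD' | rewrite /word /= sy'].
- by rewrite /final /= slideK.
- rewrite /events /= -{1}(upK i k) -{1}(upK i l).
  by apply: MoveLeftCusp; apply/eqP; rewrite ?k0 ?k1 ?l0 ?l1.
Qed.

(** The entry could change only through an index strictly between i and i+1. *)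
Lemma incid_slide_succ C x i : is_occ C -> slidable C x ->
  incid (slide x C) i.+1 i = incid C i.+1 i.
Proof.
case: x => k l oC sx; rewrite incid_slide //; have /and3P[/= lk _ _] := sx.
have -> : (i.+1 == k) && incid C l i = false.
  by apply/negP => /andP[/eqP e /(occ_incid oC)[]]; lia.
have -> : (i == l) && incid C i.+1 k = false.
  by apply/negP => /andP[/eqP e /(occ_incid oC)[]]; lia.
by rewrite !addbF.
Qed.

Lemma incid_slides_succ C V i : is_occ C -> word C V ->
  incid (slides C V) i.+1 i = incid C i.+1 i.
Proof.
elim: V C => //= x V IH C oC /andP[sx wV].
by rewrite IH ?incid_slide_succ //; apply: is_occ_slide.
Qed.

Lemma word_commute_seq C x W : is_occ C -> slidable C x -> word C W ->
  all (commuting x) W -> word_equiv C (x :: W) (rcons W x).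
Proof.
elim: W C => [|y W IH] C oC sx; first by move=> *; apply: word_equiv_refl; rewrite /word /= sx.
case/andP=> sy wW /andP[cxy cW].
apply: (@word_equiv_trans _ _ ([:: y; x] ++ W)).
  by apply: (@word_equiv_catr _ _ [:: _; _] [:: _; _]) => //; apply: word_commute.
rewrite rcons_cons; apply: (@word_equiv_catl _ [:: y] (x :: W) (rcons W x)) => //=.
  by rewrite sy.
by apply: IH => //; apply: is_occ_slide.
Qed.

(** x = W1 x W2 x = W1 W2 x x = W1 W2: since a mark is its own inverse, a trivial word that contains
    it expresses it by the other factors. *)
Lemma word_cancel_commuting C x W1 W2 : is_occ C ->
  word_equiv C [::] (W1 ++ x :: W2) -> all (commuting x) W2 ->
  word_equiv C [:: x] (W1 ++ W2).
Proof.
move=> oC E cW; have [_ ] := E; rewrite word_cat /= => /andP[w1 /andP[sx w2]] _.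
have wx : word C [:: x] by rewrite /word /= sx.
have o1 := is_occ_slides oC w1.
apply: word_equiv_trans (word_equiv_catr oC wx E) _; rewrite -catA.
apply: word_equiv_catl => //.
apply: (@word_equiv_trans _ _ (rcons W2 x ++ [:: x])).
  apply: (@word_equiv_catr _ _ (x :: W2)); rewrite ?word_slides //.
  by apply: word_commute_seq; rewrite ?slidable_slides ?word_slides.
rewrite -cats1 -catA -[in X in word_equiv _ _ X](cats0 W2).
apply: word_equiv_catl; rewrite ?word_slides //.
apply: word_cancel; rewrite ?slidable_slides //.
by apply: is_occ_slides; rewrite ?word_slides.
Qed.

Lemma mem_homotopy_word C k l x : (x \in homotopy_word C k l) =
  (x.1 == k) && incid C l x.2 || (x.2 == l) && incid C x.1 k.
Proof.
case: x => a b /=; rewrite mem_cat; congr (_ || _).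
  apply/mapP/andP => [[v] |[/eqP-> h]].
    by rewrite mem_filter => /andP[h _] [-> ->].
  exists b => //; rewrite mem_filter h mem_iota /=.
  by have /andP[] := incid_rank h.
apply/mapP/andP => [[v] |[/eqP-> h]].
  by rewrite mem_filter => /andP[h _] [-> ->].
exists a => //; rewrite mem_filter h mem_iota /=.
by have /andP[] := incid_rank h.
Qed.

(** The two halves could share only [h_{k,l}], which would put y_l into its own boundary. Hence
    deleting a factor leaves no second copy of it. *)
Lemma uniq_homotopy_word C k l : is_occ C -> l < k -> uniq (homotopy_word C k l).
Proof.
move=> oC lk; rewrite cat_uniq !map_inj_uniq ?filter_uniq ?iota_uniq //=; last 2 first.
- by move=> u v [].
- by move=> u v [].
rewrite andbT; apply/hasPn => x /mapP[u _ ->]; apply/mapP => -[v].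
by rewrite mem_filter => /andP[/(occ_incid oC)[]] + _ _ [_ e]; rewrite e ltnn.
Qed.

Lemma word_replace C i x : is_occ C -> incid C i.+1 i -> slidable C x ->
  exists2 W, all (avoids_cusp i) W & word_equiv C [:: x] W.
Proof.
move=> oC inc; case: x => k l sx; have /and3P[/= lk rk /eqP dkl] := sx.
have [_ di] := occ_incid oC inc.
case: (boolP (avoids_cusp i (k, l))) => [h|nh].
  exists [:: (k, l)]; first by rewrite /= h.
  by apply: word_equiv_refl; rewrite /word /= sx.
have [k' [l' [H1 H2 H3 h1 h2]]] : exists k' l', [/\ l' < k', k' < rank C,
   degn C l' = (degn C k' + 1)%R, (k, l) \in homotopy_word C k' l'
   & forall y, y \in homotopy_word C k' l' ->
       commuting (k, l) y && ((y == (k, l)) || avoids_cusp i y)].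
  move: nh.
  rewrite {1}/avoids_cusp negb_and !negbK /=.
  (* The degrees of y_{i+1} and y_i differ by one, so no mark joins the two cusp strands. *)
  have nii : k = i.+1 -> l = i -> False.
    move=> ek el; move: di; rewrite -ek -el dkl => /eqP.
    by rewrite -subr_eq0 opprD addrA subrr sub0r oppr_eq0.
  (* Homotopy y_i to y_l: since d y_{i+1} contains y_i, the mark [h_{i+1,l}] is a factor. The others
     are [h_{i,v}], which are absorbed, and [h_{u,l}] with u > i+1, which pass. *)
  case: (eqVneq k i.+1) => [ek _|nk].
    have li : l < i by lia.
    exists i, l; split=> [//|||| [a b]]; first by lia.
    - by rewrite -dkl ek di.
    - by rewrite mem_homotopy_word /= ek inc eqxx orbT.
    rewrite mem_homotopy_word /commuting /avoids_cusp /= xpair_eqE.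
    by case/orP=> /andP[/eqP-> /(occ_incid oC)[h _]]; lia.
  (* Homotopy y_k to y_{i+1}: now [h_{k,i}] is a factor, the other [h_{k,v}] have v < i and pass,
     and the [h_{u,i+1}] are absorbed. *)
  case: (eqVneq l i) => [el _|nl].
    have ki : i.+1 < k by lia.
    exists k, i.+1; split=> [//|//||| [a b]].
    - by rewrite dkl el di.
    - by rewrite mem_homotopy_word /= el inc eqxx.
    rewrite mem_homotopy_word /commuting /avoids_cusp /= xpair_eqE.
    by case/orP=> /andP[/eqP-> /(occ_incid oC)[h _]]; lia.
  by [].
have := word_homotopy oC H1 H2 H3; have := uniq_homotopy_word oC H1.
case/splitPr: h1 h2 => W1 W2 h2 u E.
have hW y : y \in W1 ++ W2 -> y != (k, l) /\ y \in W1 ++ (k, l) :: W2.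
  rewrite !mem_cat inE => hy; split; last by case/orP: hy => ->; rewrite ?orbT.
  move: u; rewrite uniq_catC /= mem_cat => /andP[n _]; apply: contraNneq n => <-.
  by rewrite orbC.
exists (W1 ++ W2).
  apply/allP => y /hW[ny /h2 /andP[_]]; by rewrite (negbTE ny).
apply: word_cancel_commuting => //; apply/allP => y hy.
by have /hW[_ /h2 /andP[]] : y \in W1 ++ W2 by rewrite mem_cat hy orbT.
Qed.

Lemma word_avoiding_cusp C i V : is_occ C -> incid C i.+1 i -> word C V ->
  exists2 W, all (avoids_cusp i) W & word_equiv C V W.
Proof.
elim: V C => [|x V IH] C oC inc; first by exists [::] => //; apply: word_equiv_refl.
case/andP=> sx wV; have ox := is_occ_slide oC sx.
have inc' : incid (slide x C) i.+1 i by rewrite incid_slide_succ.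
have [W1 a1 E1] := IH _ ox inc' wV.
have [W2 a2 E2] := word_replace oC inc sx.
have w1 : word C W1 by case: E1.
exists (W2 ++ W1); first by rewrite all_cat a2.
apply: word_equiv_trans (word_equiv_catr oC w1 E2).
by apply: (@word_equiv_catl _ [:: x]) => //; rewrite /word /= sx.
Qed.

(** * Simple births and the sweep *)

Definition birth_mark i (x : nat * nat) :=
  ((x.2 == i.+1) && (i.+1 < x.1)) || ((x.1 == i) && (x.2 < i)).

Lemma birth_slide i A B x : is_occ A -> is_occ B -> slidable B x -> birth_mark i x ->
  birth i A B -> birth i A (slide x B) /\
  tail_equiv A [:: (Lc i, B)] [:: (Lc i, slide x B); (Hs x.1 x.2, B)].
Proof.
case: x => k l oA oB sx hx hB; have ox := is_occ_slide oB sx.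
have sx' : slidable (slide (k, l) B) (k, l) by rewrite slidable_slide.
have h : birth i A (slide (k, l) B).
  move: hB; rewrite /birth -{1}(slideK sx).
  case/orP: hx sx' ox => /= /andP[/eqP e _] sx' ox; subst.
    exact: death_slide_above.
  exact: death_slide_below.
split=> //; apply: tail_equiv_sym; apply: tail_equiv_move => //.
  split=> //; split=> //; apply/handleslideP.
  by rewrite slideK.
case/orP: hx => /= /andP[/eqP e h']; subst.
  exact: MoveLeftCuspAbove.
exact: MoveLeftCuspBelow.
Qed.

(** The reversed word undoes the slides, so the complex that faces the rest of the tail is [B]
    again. *)
Lemma birth_slides i A B W : is_occ A -> is_occ B -> word B W ->
  all (birth_mark i) W -> birth i A B ->
  birth i A (slides B W) /\
  tail_equiv A [:: (Lc i, B)] ((Lc i, slides B W) :: run (slides B W) (rev W)).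
Proof.
elim: W B => [|x W IH] B oA oB; first by split=> //; apply: tail_equiv_refl.
case/andP=> sx wW /andP[bx bW] hB.
have [hB' E] := birth_slide oA oB sx bx hB.
have ox := is_occ_slide oB sx.
have [h2 E2] := IH _ oA ox wW bW hB'.
split=> //=; apply: tail_equiv_trans E _.
rewrite rev_cons -cats1 run_cat slides_rev //= slideK //.
apply: (@tail_equiv_catr _ [:: (Hs x.1 x.2, B)] [:: _] (_ :: _) _ E2).
split=> //; case: (x) sx => k l sx; apply/handleslideP.
by rewrite slideK.
Qed.

(** Gaussian elimination with the entry (i+1, i) as pivot: slides [h_{i,l}] clear row i+1, then
    slides [h_{u,i+1}] clear column i. The latter add columns u > i+1, where row i+1 is zero, so
    that row stays clear. *)
Lemma slides_simple_birth i A B : is_occ A -> is_occ B -> birth i A B ->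
  exists W, [/\ word B W, all (birth_mark i) W,
    forall m, incid (slides B W) i.+1 m = (m == i)
  & forall j, incid (slides B W) j i = (j == i.+1)].
Proof.
move=> oA oB /(deathE _ _ oB)[_ hi inc _ _].
have [_ di] := occ_incid oB inc.
pose ls := [seq l <- iota 0 i | incid B i.+1 l].
(* This range overshoots the rank; [incid] is false there. *)
pose us := [seq u <- iota i.+2 (rank B) | incid B u i].
have w1 : word B [seq (i, l) | l <- ls].
  apply/allP => x /mapP[l]; rewrite mem_filter mem_iota => /andP[hl /= li] ->.
  have [_ dl] := occ_incid oB hl.
  rewrite /slidable /= (ltnW hi) add0n in li *; rewrite li /=.
  by apply/eqP/(addIr (1%R : int)); rewrite -di.
have w2 : word B [seq (u, i.+1) | u <- us].
  apply/allP => x /mapP[u]; rewrite mem_filter mem_iota => /andP[hu /andP[iu _]] ->.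
  have [_ du] := occ_incid oB hu; have /andP[ru _] := incid_rank hu.
  by rewrite /slidable /= iu ru /= du di.
have u1 : uniq ls by rewrite filter_uniq ?iota_uniq.
have u2 : uniq us by rewrite filter_uniq ?iota_uniq.
exists ([seq (i, l) | l <- ls] ++ [seq (u, i.+1) | u <- us]).
set B1 := slides B [seq (i, l) | l <- ls].
have o1 : is_occ B1 by exact: is_occ_slides.
have n1 : (i.+1 == i) = false by rewrite (gtn_eqF (ltnSn i)).
have n2 : (i == i.+1) = false by rewrite (ltn_eqF (ltnSn i)).
have f1 m : incid B1 i.+1 m = (m == i).
  rewrite incid_slides_row // n1 inc andbT /= addbF mem_filter mem_iota /= add0n.
  case: (ltngtP m i) => [mi|im|->].
  - by rewrite andbT addbb.
  - by rewrite andbF addbF occ_incid_ge.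
  - by rewrite inc andbF.
have f2 j : incid B1 j i = incid B j i.
  rewrite incid_slides_row // mem_filter mem_iota /= add0n ltnn andbF /= addbF.
  case: eqVneq => [->|_] /=; last by rewrite addbF.
  rewrite big_seq big1 ?addbF // => v; rewrite mem_filter mem_iota /= add0n => /andP[_ vi].
  by rewrite occ_incid_ge // ltnW.
split.
- by rewrite word_cat w1.
- rewrite all_cat; apply/andP; split; apply/allP => x /mapP[v].
    rewrite mem_filter mem_iota /= add0n => /andP[_ vi] ->.
    by rewrite /birth_mark /= eqxx vi orbT.
  rewrite mem_filter mem_iota => /andP[_ /andP[vi _]] ->.
  by rewrite /birth_mark /= eqxx vi.
- move=> m; rewrite slides_cat incid_slides_col ?word_slides // !f1.
  rewrite mem_filter mem_iota ltnn andbF /= addbF.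
  rewrite big_seq big1 ?andbF ?addbF // => u; rewrite mem_filter mem_iota => /andP[_ /andP[iu _]].
  by rewrite f1; apply/gtn_eqF/ltnW.
- move=> j; rewrite slides_cat incid_slides_col ?word_slides // f1 f2 eqxx n2 /= andbT addbF.
  rewrite mem_filter mem_iota.
  case: (ltngtP j i.+1) => [ji|ij|->].
  - by rewrite andbF addbF occ_incid_ge.
  - case h : (incid B j i) => //=; have /andP[rj _] := incid_rank h.
    by rewrite (ltn_addl _ rj).
  - by rewrite andbF inc.
Qed.

(** The birth is made simple after the word has passed; the marks that undo the simplification,
    [rev W], go in front of the passed word. *)
Lemma left_cusp_pass i C V D : is_occ C -> is_occ D -> word C V ->
  step (Lc i) (slides C V) D ->
  exists D' W, [/\ step (Lc i) C D', is_occ D', word D' W,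
    (forall m, incid D' i.+1 m = (m == i)) /\ (forall j, incid D' j i = (j == i.+1)) &
    tail_equiv C (run C V ++ [:: (Lc i, D)]) ((Lc i, D') :: run D' W)].
Proof.
move=> oC oD wV h.
have [|D1 [W1 [h1 o1 w1 E1]]] :=
  @pass_word (Lc i) xpredT (@pass_left_cusp i) V C D oC oD wV _ h; first exact: all_predT.
have [W [wW bW f1 f2]] := slides_simple_birth oC o1 h1.
have [h2 E2] := birth_slides oC o1 wW bW h1.
have o2 := is_occ_slides o1 wW.
exists (slides D1 W), (rev W ++ W1); split=> //.
  by rewrite word_cat !word_slides w1 /word all_rev andbT.
apply: tail_equiv_trans E1 _.
rewrite run_cat slides_rev //.
apply: (@tail_equiv_catr _ (run D1 W1) [:: _] (_ :: _) _ E2).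
exact: vsteps_run.
Qed.

Lemma right_cusp_pass i C V D : is_occ C -> is_occ D -> word C V ->
  step (Rc i) (slides C V) D ->
  exists D' W, [/\ step (Rc i) C D', is_occ D', word D' W &
    tail_equiv C (run C V ++ [:: (Rc i, D)]) ((Rc i, D') :: run D' W)].
Proof.
move=> oC oD wV h; have oV := is_occ_slides oC wV.
have inc : incid C i.+1 i.
  by have [_ _ + _ _] := (deathE _ _ oV).1 h; rewrite incid_slides_succ.
have [W aW E] := word_avoiding_cusp oC inc wV.
have [_ wW tE] := E; rewrite (word_equiv_slides E) in h.
have [D' [W' [h' o' w' E']]] := pass_word (@pass_right_cusp i) oC oD wW aW h.
exists D', W'; split=> //; apply: tail_equiv_trans E'.
apply: tail_equiv_catr => //.
by rewrite final_run (word_equiv_slides E).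
Qed.

Definition swap_word i (b : bool) := if b then [:: (i.+1, i)] else [::].

Lemma crossing_pass i C V D : is_occ C -> is_occ D -> word C V ->
  step (Cr i) (slides C V) D ->
  exists b D' W, let P := swap_word i b in
   [/\ word C P, step (Cr i) (slides C P) D', is_occ D', word D' W &
    tail_equiv C (run C V ++ [:: (Cr i, D)]) (run C P ++ (Cr i, D') :: run D' W)].
Proof.
move=> oC oD wV h.
have [b [V' nV' E]] := word_extract_swap i oC wV.
have eV : (if b then (i.+1, i) :: V' else V') = swap_word i b ++ V' by case: b {E}.
rewrite eV in E; have [_ wV' tE] := E.
move: (wV'); rewrite word_cat => /andP[wP wV2].
rewrite (word_equiv_slides E) slides_cat in h.
have oP := is_occ_slides oC wP.
have aV : all (predC1 (i.+1, i)) V'.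
  by apply/allP => x hx /=; apply: contraNneq nV' => <-.
have [D' [W [h' o' w' E']]] :=
  @pass_word (Cr i) (predC1 (i.+1, i)) (@pass_crossing i) V' (slides C (swap_word i b)) D oP oD
    (etrans (word_slides _ _ _) wV2) aV h.
exists b, D', W; split=> //.
apply: tail_equiv_trans (tail_equiv_catr _ tE) _.
  by rewrite /= final_run (word_equiv_slides E) slides_cat.
rewrite run_cat -catA; apply: tail_equiv_catl; first exact: vsteps_run.
by rewrite final_run.
Qed.

(** In [sweep], [I] is an invariant of the complex at the sweep line and [F] is
    the normal form required of the part already swept. *)
Section Sweep.
Variables (I : occ -> Prop) (F : occ -> seq (event * occ) -> Prop).
Hypothesis F_nil : forall C, F C [::].
Hypothesis F_cat : forall C q q', F C q -> F (final C q) q' -> F C (q ++ q').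
Hypothesis F_step : forall C V e D, is_occ C -> is_occ D -> I C -> word C V ->
  ~~ is_mark e -> step e (slides C V) D ->
  exists q W, [/\ F C q, I (final C q), word (final C q) W
    & tail_equiv C (run C V ++ [:: (e, D)]) (q ++ run (final C q) W)].

(** A mark ahead joins the word; a singularity calls [F_step], whose output word again ends at the
    complex [D] of the original tail, so the remaining tail is reused verbatim. *)
Lemma sweep q C V : is_occ C -> I C -> word C V -> vsteps (slides C V) q ->
  exists q' W, [/\ F C q', word (final C q') W
    & tail_equiv C (run C V ++ q) (q' ++ run (final C q') W)].
Proof.
elim: q C V => [|[e D] q IH] C V oC iC wV.
  by exists [::], V; split=> //; rewrite cats0; apply: tail_equiv_refl.
case=> h oD vq; have oV := is_occ_slides oC wV.
case: (boolP (is_mark e)) => [me|ne].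
  case: e me h => // k l _ /handleslideP[sx eD].
  have wV' : word C (rcons V (k, l)).
    by rewrite /word all_rcons -/(word C V) wV andbT -(slidable_slides C V).
  have eS : slides C (rcons V (k, l)) = D by rewrite -cats1 slides_cat eD.
  have [|q' [W [h1 h2 h3]]] := IH C (rcons V (k, l)) oC iC wV'; first by rewrite eS.
  exists q', W; split=> //; move: h3; rewrite -cats1 run_cat /= -catA /=.
  by rewrite eD.
have [q0 [W0 [h1 h2 h3 h4]]] := F_step oC oD iC wV ne h.
have v0 : vsteps C (q0 ++ run (final C q0) W0).
  apply/(tail_equiv_vsteps h4)/vsteps_cat; split; first exact: vsteps_run.
  by rewrite final_run.
have o0 : is_occ (final C q0) by apply: vsteps_final => //; have [] := (vsteps_cat _ _ _).1 v0.
have e0 : slides (final C q0) W0 = D.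
  by rewrite -final_run -final_cat -(tail_equiv_final h4) final_cat.
have [|q' [W [h5 h6 h7]]] := IH _ W0 o0 h2 h3; first by rewrite e0.
exists (q0 ++ q'), W; split.
- exact: F_cat.
- by rewrite final_cat.
have -> : run C V ++ (e, D) :: q = (run C V ++ [:: (e, D)]) ++ q by rewrite -catA.
apply: tail_equiv_trans (tail_equiv_catr _ h4) _.
  by rewrite final_cat.
rewrite -catA -catA final_cat; apply: tail_equiv_catl => //.
by have [] := (vsteps_cat _ _ _).1 v0.
Qed.

End Sweep.

(** A recursive form of the quantification over splittings in the target predicates. The rest of the
    tail is an argument because a mark must be followed at once by its crossing. *)
Fixpoint all_tails (P : event * occ -> seq (event * occ) -> Prop) q : Prop :=
  if q is x :: q' then P x q' /\ all_tails P q' else True.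

Lemma all_tailsP P q :
  all_tails P q -> forall p x q', q = p ++ x :: q' -> P x q'.
Proof.
elim: q => [_ [] //|y q IH [h1 h2] [|z p] x q' /= [e1 e2]]; first by rewrite -e1 -e2.
exact: (IH h2 p).
Qed.

Lemma all_tails_cat (P : event * occ -> seq (event * occ) -> Prop) q q' :
  (forall x q q', P x q -> P x (q ++ q')) ->
  all_tails P q -> all_tails P q' -> all_tails P (q ++ q').
Proof.
by move=> hP; elim: q => //= x q IH [h1 h2] h3; split; [apply: hP | apply: IH].
Qed.

Definition simple_birth_at (x : event * occ) (_ : seq (event * occ)) : Prop :=
  if x.1 is Lc k then simple_birth k x.2 else True.

Definition mark_at_crossing (x : event * occ) (q : seq (event * occ)) : Prop :=
  if x.1 is Hs k l then k = l.+1 /\ exists D q', q = (Cr l, D) :: q' else True.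

Lemma simple_birthP i C :
  (forall m, incid C i.+1 m = (m == i)) -> (forall j, incid C j i = (j == i.+1)) ->
  simple_birth i C.
Proof.
move=> f1 f2; split; last by move=> j; rewrite f2 => /eqP.
by apply/rowP => m; rewrite gen_bdE f1 mxE.
Qed.

Lemma a_form_sweep C V q : is_occ C -> word C V -> vsteps (slides C V) q ->
  exists q' W, [/\ all_tails simple_birth_at q' /\ all_tails mark_at_crossing q',
    word (final C q') W & tail_equiv C (run C V ++ q) (q' ++ run (final C q') W)].
Proof.
move=> oC; apply: (@sweep (fun=> True)
   (fun _ q => all_tails simple_birth_at q /\ all_tails mark_at_crossing q)) => //.
  move=> {C V q oC} C q q' [h1 h2] [h3 h4]; split; apply: all_tails_cat => //.
  by move=> [[k l|i|i|i] D] // q1 q2 [-> [D' [q3 ->]]]; split=> //; exists D', (q3 ++ q2).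
move=> {C V q oC} C V [//|i|i|i] D oC oD _ wV _ h.
- have [b [D' [W [wP h' oD' wW E]]]] := crossing_pass oC oD wV h.
  exists (run C (swap_word i b) ++ [:: (Cr i, D')]), W.
  rewrite final_cat /=; split=> //; last by rewrite -catA.
  case: b {wP h' E} => //; split=> //=; split=> //; split=> //.
  by exists D', [::].
- have [D' [W [h' oD' wW E]]] := right_cusp_pass oC oD wV h.
  by exists [:: (Rc i, D')], W.
- have [D' [W [h' oD' wW fs E]]] := left_cusp_pass oC oD wV h.
  exists [:: (Lc i, D')], W; split=> //; split=> //; split=> //.
  by case: fs; apply: simple_birthP.
Qed.

(** * Transfer to Morse complex sequences *)

Lemma vstepsP C q :
  (forall p, p <= size q -> is_occ (nth C (C :: [seq x.2 | x <- q]) p)) /\ steps C q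
  <-> is_occ C /\ vsteps C q.
Proof.
split=> [[h s]|].
  split; first exact: (h 0).
  elim: q C h s => [//|[e D] q IH] C h [s1 s2]; split=> //; first exact: (h 1).
  apply: IH s2 => p hp; have := h p.+1 hp => /=.
  by rewrite (set_nth_default D) //= size_map ltnS.
move=> [oC]; elim: q C oC => [|[e D] q IH] C oC.
  by move=> _; split=> // -[].
case=> s oD /(IH _ oD) [h1 h2]; split=> // -[//|p] hp.
by have := h1 p hp; rewrite /= (set_nth_default C) //= size_map ltnS.
Qed.

Definition sings (q : seq (event * occ)) := [seq e <- events q | ~~ is_mark e].

(** Marks keep degrees, so these are the degree sequences over the intervals between singularities,
    except the first interval. *)
Definition profile (q : seq (event * occ)) : seq (seq int) :=
  [seq deg x.2 : seq int | x <- q & ~~ is_mark x.1].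

Lemma sings_cat p q : sings (p ++ q) = sings p ++ sings q.
Proof. by rewrite /sings /events map_cat filter_cat. Qed.

Lemma profile_cat p q : profile (p ++ q) = profile p ++ profile q.
Proof. by rewrite /profile filter_cat map_cat. Qed.

Lemma sings_cons e D q :
  sings ((e, D) :: q) = if is_mark e then sings q else e :: sings q.
Proof. by rewrite /sings /=; case: (is_mark e). Qed.

Lemma profile_cons e D q :
  profile ((e, D) :: q) = if is_mark e then profile q else (deg D : seq int) :: profile q.
Proof. by rewrite /profile /=; case: (is_mark e). Qed.

Lemma size_sings q : size (sings q) = num_singularities q.
Proof. by rewrite size_filter. Qed.

Lemma step_mark_deg e C D : is_mark e -> step e C D -> is_occ C ->
  deg D = deg C :> seq int.
Proof. by case: e => // k l _ /handleslideP[_ ->]. Qed.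

Lemma profile_marks C q : is_occ C -> vsteps C q -> sings q = [::] ->
  profile q = [::] /\ deg (final C q) = deg C :> seq int.
Proof.
elim: q C => [//|[e D] q IH] C oC [h oD v]; rewrite sings_cons profile_cons.
case: (boolP (is_mark e)) => // me hq.
have [p0 e2] := IH D oD v hq; split; first exact: p0.
exact: etrans e2 (step_mark_deg me h oC).
Qed.

(** A local move contains at most one singularity, so the degrees that it records are those of its
    final complex, which the move keeps. *)
Lemma profile_le1 C q : is_occ C -> vsteps C q -> size (sings q) <= 1 ->
  profile q = nseq (size (sings q)) (deg (final C q) : seq int).
Proof.
elim: q C => [//|[e D] q IH] C oC [h oD v].
have fE : final C ((e, D) :: q) = final D q by [].
rewrite fE; have IHq := IH D oD v.
rewrite sings_cons profile_cons.
case: (boolP (is_mark e)) => /= me; first exact: IHq.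
rewrite ltnS leqn0 => /nilP s0.
have [p0 d0] := profile_marks oD v s0.
by rewrite s0 p0 /= d0.
Qed.

Lemma local_move_sings A q q' : local_move A (events q) (events q') ->
  sings q = sings q' /\ size (sings q) <= 1.
Proof.
have z (f : nat -> event) (r : seq nat) : (forall x, is_mark (f x)) ->
    [seq e <- [seq f x | x <- r] | ~~ is_mark e] = [::].
  by move=> hf; elim: r => //= x r ->; rewrite hf.
by rewrite /sings; case=> // k l _ _ _; rewrite filter_cat !z.
Qed.

Lemma tail_move_profile C t t' : is_occ C -> tail_move C t t' ->
  sings t = sings t' /\ profile t = profile t'.
Proof.
move=> oC [v v' [p [q [q' [r [e1 e2 e h]]]]]]; subst t t'.
have [s s1] := local_move_sings h.
move: v => /vsteps_cat[vp /vsteps_cat[vq _]].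
move: v' => /vsteps_cat[_ /vsteps_cat[vq' _]].
have oA := vsteps_final oC vp.
rewrite !sings_cat !profile_cat s (profile_le1 oA vq s1).
by rewrite (@profile_le1 _ q' oA vq') -s // e.
Qed.

Lemma deg_nth_profile C q p : is_occ C -> vsteps C q -> p <= size q ->
  (deg (nth C (C :: [seq x.2 | x <- q]) p) : seq int) =
  nth [::] ((deg C : seq int) :: profile q) (num_singularities (take p q)).
Proof.
elim: p C q => [|p IH] C [|[e D] q] oC //= [h oD v] hp.
have E : nth C [seq x.2 | x <- (e, D) :: q] p = nth D (D :: [seq x.2 | x <- q]) p.
  by rewrite (set_nth_default D) //= size_map ltnS.
rewrite E (IH D q oD v hp) -!size_sings sings_cons profile_cons.
by case: (boolP (is_mark e)) => me //; rewrite (step_mark_deg me h oC).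
Qed.

Lemma num_singularities_take t n : n <= num_singularities t ->
  exists2 p, p <= size t & num_singularities (take p t) = n.
Proof.
elim: t n => [|[e D] t IH] [|n]; try by exists 0.
rewrite -size_sings sings_cons; case: (boolP (is_mark e)) => me; rewrite /= ?ltnS size_sings.
all: move=> /IH[p hp <-]; exists p.+1 => //.
all: by rewrite -!size_sings /= sings_cons ?me ?(negbTE me).
Qed.

Section Transfer.
Variables (R : realType) (K : space_curve R) (mu : R -> int).

Lemma is_mcs_vsteps M : is_mcs K mu M -> is_occ (start M) /\ vsteps (start M) (tail M).
Proof. by case: M => C q [h1 h2 _ _ _]; apply/vstepsP. Qed.

(** Positions in the two tails do not correspond, only the intervals between singularities do: a
    position of [t] with the same count of singularities supplies the slice. *)
Lemma is_mcs_transfer C t t' : is_mcs K mu (Mcs C t) -> vsteps C t' ->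
  final C t = final C t' -> sings t = sings t' -> profile t = profile t' ->
  is_mcs K mu (Mcs C t').
Proof.
move=> hM v' ef es ep; have [oC v] := is_mcs_vsteps hM.
case: hM => h1 h2 h3 h4 [xs fr hx].
have [h1' h2'] := (vstepsP C t').2 (conj oC v').
split=> //; first by rewrite /= -ef.
exists xs; first by move: fr; rewrite /front_word /= -!/(sings _) es.
move=> p x hp j hj.
have [p' hp' ejp] : exists2 p', p' <= size t & num_singularities (take p' t) = j.
  have : j <= num_singularities t.
    rewrite -(size_sings t) es size_sings /j /num_singularities /events.
    by rewrite -{2}(cat_take_drop p t') map_cat count_cat leq_addr.
  exact: num_singularities_take.
have [|ts hts hd] := hx p' x hp'; first by rewrite /= ejp.
exists ts => //; rewrite /= (deg_nth_profile oC v' hp) -ep -hd.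
by rewrite (deg_nth_profile oC v hp') ejp.
Qed.

Lemma tail_equiv_mcs C t t' : tail_equiv C t t' ->
  (is_mcs K mu (Mcs C t) <-> is_mcs K mu (Mcs C t')) /\
  (is_mcs K mu (Mcs C t) -> mcs_equiv K mu (Mcs C t) (Mcs C t')).
Proof.
elim=> {t t'} [t t' m|t|t1 t2 _ [h1 h2]|t1 t2 t3 _ [h1 h2] _ [h3 h4]].
- have [v v' [p [q [q' [r [e1 e2 e h]]]]]] := m.
  have ef : final C t = final C t' by apply/tail_equiv_final/rst_step.
  have E : is_mcs K mu (Mcs C t) <-> is_mcs K mu (Mcs C t').
    split=> hM; have [oC _] := is_mcs_vsteps hM; have [es ep] := tail_move_profile oC m;
    by apply: is_mcs_transfer hM _ _ _ _.
  split=> // hM; apply: rst_step; split=> //; first exact/E.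
  by exists C, p, q, q', r; rewrite e1 e2.
- by split=> // _; apply: rst_refl.
- by split=> [|h]; [tauto | apply/rst_sym/h2/h1].
- by split=> [|h]; [tauto | apply: rst_trans (h2 h) (h4 _); apply/h1].
Qed.

Lemma elementary_rank_deg C : is_occ C -> elementary C ->
  rank C = 2 /\ (forall j m, incid C j m = (j == 1) && (m == 0)).
Proof.
move=> oC [r2 h]; split=> // j m.
have r1 : 0 < rank C by rewrite r2.
have inc : incid C 1 0.
  have := congr1 (fun v : 'rV_(rank C) => v 0%R (Ordinal r1) == 1%R) h.
  by rewrite gen_bdE mxE F2_eq1_nat /= eqxx.
apply/idP/andP => [hi|[/eqP-> /eqP->] //].
have [lt _] := occ_incid oC hi; have := incid_rank hi; rewrite r2; lia.
Qed.

Lemma elementary_word C V : is_occ C -> elementary (slides C V) -> word C V -> V = [::].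
Proof.
move=> oC el wV; have oV := is_occ_slides oC wV.
have [r2 f] := elementary_rank_deg oV el.
have [|_ d] := @occ_incid _ oV 1 0; first by rewrite f.
case: V wV {el f r2 oV} (r2) d => // -[k l] V /andP[/and3P[/= lk rk dkl] wV].
rewrite rank_slides => r2; rewrite !degn_slides !degn_slide => d.
have [ek el] : k = 1 /\ l = 0 by rewrite r2 in rk; lia.
by move: dkl; rewrite ek el d -subr_eq0 addrC addrA addNr add0r.
Qed.

Lemma mcs_normalize (F : seq (event * occ) -> Prop) C t :
  is_mcs K mu (Mcs C t) ->
  (exists q W, [/\ F q, word (final C q) W & tail_equiv C t (q ++ run (final C q) W)]) ->
  exists q, [/\ is_mcs K mu (Mcs C q), mcs_equiv K mu (Mcs C t) (Mcs C q) & F q].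
Proof.
move=> hM [q [W [hF wW E]]]; have [h1 h2] := tail_equiv_mcs E.
have hM' := h1.1 hM; have [oC] := is_mcs_vsteps hM'; rewrite /= => /vsteps_cat[vq _].
have oq := vsteps_final oC vq.
have W0 : W = [::].
  apply: (elementary_word oq) wW.
  by case: hM' => _ _ _; rewrite /= final_cat final_run.
move: E hM'; rewrite W0 cats0 => E hM'; exists q; split=> //.
by have := h2 hM; rewrite W0 cats0.
Qed.

Lemma a_form_exists M : is_mcs K mu M ->
  exists M', [/\ is_mcs K mu M', mcs_equiv K mu M M' & a_form M'].
Proof.
case: M => C t hM; have [oC v] := is_mcs_vsteps hM.
have [q [h1 h2 [b m]]] := mcs_normalize hM (@a_form_sweep C [::] t oC isT v).
exists (Mcs C q); split=> //; split.
  by move=> p k B q' e; apply: (all_tailsP b e).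
by move=> p k l B q' e; apply: (all_tailsP m e).
Qed.
End Transfer.

(** * Simple forms and companions *)

Lemma simple_formP C : simple_form C <->
  (forall j m m', incid C j m -> incid C j m' -> m = m') /\
  (forall j j' m, incid C j m -> incid C j' m -> j = j').
Proof.
have row1 (j m : 'I_(rank C)) : row j (bd C) = delta_mx 0%R m ->
    forall p, incid C j p = (p == m).
  move=> e p; case rp : (p < rank C); last first.
    have -> : incid C j p = false by rewrite incid_ge // orbC leqNgt rp.
    apply/esym/eqP => e'.
    by move: rp; rewrite e' ltn_ord.
  have := congr1 (fun v : 'rV_(rank C) => v 0%R (Ordinal rp) == 1%R) e.
  by rewrite !mxE bdE F2_eq1_nat eqxx /= F2_eq1_nat => ->.
have row0 (j : 'I_(rank C)) : row j (bd C) = 0%R -> forall p, incid C j p = false.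
  move=> e p; case rp : (p < rank C); last by rewrite incid_ge // orbC leqNgt rp.
  have := congr1 (fun v : 'rV_(rank C) => v 0%R (Ordinal rp) == 1%R) e.
  by rewrite !mxE bdE F2_eq1_nat eq_sym oner_eq0.
split=> [[h1 h2]|[h1 h2]].
  split=> [j m m' i1 i2|j j' m i1 i2].
    have /andP[rj rm] := incid_rank i1.
    case: (h1 (Ordinal rj)) => [/row0 z|[p /row1 z]]; first by move: i1; rewrite z.
    by move: i1 i2; rewrite !z => /eqP-> /eqP->.
  have /andP[rj rm] := incid_rank i1; have /andP[rj' _] := incid_rank i2.
  case: (h1 (Ordinal rj)) => [/row0 z|[p zp]]; first by move: i1; rewrite z.
  case: (h1 (Ordinal rj')) => [/row0 z|[p' zp']]; first by move: i2; rewrite z.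
  suff : Ordinal rj = Ordinal rj' by case.
  apply: h2.
    apply/eqP => z; have := row1 _ _ zp p; rewrite (row0 _ z) eqxx.
    by [].
  rewrite zp zp'; congr delta_mx; apply/val_inj => /=.
  have := row1 _ _ zp m; rewrite i1 => /esym/eqP <-.
  by have := row1 _ _ zp' m; rewrite i2 => /esym/eqP <-.
have row_eq (j : 'I_(rank C)) : row j (bd C) != 0%R -> exists m : 'I_(rank C), incid C j m.
  move=> nz; case: (boolP [exists m : 'I_(rank C), incid C j m]) => [/existsP //|].
  rewrite negb_exists => /forallP z; case/eqP: nz; apply/rowP => m.
  by rewrite !mxE bdE (negbTE (z m)).
split=> [j|j j' nz e].
  case: (eqVneq (row j (bd C)) 0%R) => [->|/row_eq[m im]]; [by left | right].
  exists m; apply/rowP => p; rewrite !mxE bdE eqxx /=; congr (nat_of_bool _)%:R%R.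
  by apply/idP/eqP => [ip|->//]; apply/val_inj/(h1 _ _ _ ip im).
have [m im] := row_eq _ nz.
apply/val_inj/(h2 _ _ m im).
have := congr1 (fun v : 'rV_(rank C) => v 0%R m == 1%R) e.
by rewrite !mxE !bdE !F2_eq1_nat im.
Qed.

(** Some chain with leading index at most i has a boundary with leading index j.
    This is invariant under handleslides, and it determines a simple form. *)
Definition reaches C i j : Prop :=
  exists x : 'rV['F_2]_(rank C),
    [/\ forall a, x 0%R a = 1%R -> a <= i,
        exists2 a : 'I_(rank C), a = j :> nat & ((x *m bd C) 0 a = 1)%R
      & forall a : 'I_(rank C), j < a -> ((x *m bd C) 0 a = 0)%R].

(** The elementary matrix is unitriangular: it keeps the bound on the chain and the leading index of
    the boundary. *)
Lemma reaches_slide C x i j : slidable C x -> reaches C i j -> reaches (slide x C) i j.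
Proof.
case: x => k l /and3P[/= lk rk _]; have rl : l < rank C by lia.
have EE := @elemK (rank C) (Ordinal rk) (Ordinal rl) lk; rewrite /= in EE.
have MP (v : 'rV['F_2]_(rank C)) (a : 'I_(rank C)) :
    ((v *m elem (rank C) k l) 0 a = v 0 a + (a == l :> nat)%:R * v 0 (Ordinal rk))%R.
  rewrite (@elem_delta _ (Ordinal rk) (Ordinal rl)) // mulmxDr mulmx1 !mxE; congr (_ + _)%R.
  rewrite (bigD1 (Ordinal rk)) //= big1 ?addr0 => [|b nb].
    by rewrite mxE eqxx mulrC.
  by rewrite mxE (negbTE nb) mulr0.
case=> v [h1 [a ea ha] h2].
exists (v *m elem (rank C) k l)%R.
rewrite /= -!mulmxA (mulmxA (elem _ k l) (elem _ k l)) EE mul1mx mulmxA.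
split=> [b||b jb].
- rewrite MP; case: (eqVneq (v 0%R b) 1%R) => [/h1 //|nb].
  have -> : v 0%R b = 0%R by apply/eqP; rewrite -[_ == _]negbK F2_neq0.
  case: (@eqP _ (b : nat) l) => [e|_]; last by rewrite mul0r addr0.
  rewrite mul1r add0r => /h1 /=; rewrite e; exact/leq_trans/ltnW.
- exists a => //; rewrite MP ha; case: (@eqP _ (a : nat) l) => [e|_]; last by rewrite mul0r addr0.
  by rewrite h2 ?mulr0 ?addr0 //= -ea e.
- rewrite MP h2 // add0r; case: (@eqP _ (b : nat) l) => [e|_]; last by rewrite mul0r.
  by rewrite h2 ?mulr0 //= (ltn_trans jb) // e.
Qed.

Lemma reaches_handleslides C D i j : handleslides C D -> reaches C i j <-> reaches D i j.
Proof.
elim=> {C D} [C D [k [l /handleslideP[sx ->]]]|//|C D E _ h1 _ h2]; last by rewrite h1 h2.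
split; first exact: reaches_slide.
by rewrite -{2}(slideK sx); apply: reaches_slide; rewrite slidable_slide.
Qed.

(** Entry j of a boundary can be one only through a generator of the chain that hits y_j; conversely
    such a generator alone has boundary exactly y_j. *)
Lemma reaches_simple C i j : simple_form C ->
  reaches C i j <-> exists2 k, k <= i & incid C k j.
Proof.
move=> /simple_formP[s1 s2]; split=> [[x [h1 [a ea]]]|[k ki inc]].
  rewrite mxE => /eqP + _; rewrite F2_eq1_sum => hb.
  case: (boolP [exists k : 'I_(rank C), (x 0%R k == 1%R) && incid C k j]).
    by case/existsP=> k /andP[/eqP/h1 ki inc]; exists k.
  rewrite negb_exists => /forallP z; move: hb; rewrite big1 // => k _.
  by rewrite F2_eq1M -incid_ord ea; apply/negbTE/z.
have /andP[rk rj] := incid_rank inc.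
exists (delta_mx 0%R (Ordinal rk)); rewrite -rowE; split=> [a||a ja].
- by rewrite mxE eqxx /=; case: eqP => [->|_].
- by exists (Ordinal rj) => //; rewrite mxE bdE /= inc.
- rewrite mxE bdE /=; case h : (incid C k a) => //.
  by move: ja; rewrite (s1 _ _ _ inc h) ltnn.
Qed.

(** The index of the generator that hits y_m is the least i with [reaches C i m]. Comparing in both
    directions gives k' <= k <= j, and uniqueness within [D] gives k' = j. *)
Lemma simple_form_unique C D E : handleslides C D -> handleslides C E ->
  simple_form D -> simple_form E -> forall j m, incid D j m -> incid E j m.
Proof.
move=> hD hE sD sE j m inc.
have transfer k A B : handleslides C A -> handleslides C B -> simple_form A -> simple_form B ->
    incid A k m -> exists2 k', k' <= k & incid B k' m.
  move=> hA hB sA sB h; apply/(reaches_simple _ _ sB).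
  by apply/(reaches_handleslides _ _ hB)/(reaches_handleslides _ _ hA)/(reaches_simple _ _ sA); exists k.
have [k kj ik] := transfer _ _ _ hD hE sD sE inc.
have [k' kk ik'] := transfer _ _ _ hE hD sE sD ik.
have [_ s2] := (simple_formP D).1 sD.
have e := s2 _ _ _ inc ik'.
by have -> : j = k by apply/eqP; rewrite eqn_leq kj e kk.
Qed.

Definition paired C a b := incid C a b || incid C b a.

Lemma pairedC C a b : paired C a b = paired C b a.
Proof. by rewrite /paired orbC. Qed.

Lemma companionsP C E a b : handleslides C E -> simple_form E ->
  (companions C a b <-> paired E a b).
Proof.
move=> hE sE; split=> [[D [hD sD]]|h]; last by exists E.
by case/orP=> h; apply/orP; [left|right]; exact: (simple_form_unique hD hE sD sE h).
Qed.

Lemma handleslides_slides C V : word C V -> handleslides C (slides C V).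
Proof.
elim: V C => [|[k l] V IH] C /=; first by move=> _; apply: rt_refl.
case/andP=> sx wV; apply: rt_trans (IH (slide (k, l) C) wV).
by apply: rt_step; exists k, l; apply/handleslideP.
Qed.

Lemma handleslides_slides_back C V : word C V -> handleslides (slides C V) C.
Proof.
move=> wV; rewrite -{2}(slides_rev wV); apply: handleslides_slides.
by rewrite word_slides /word all_rev.
Qed.

Lemma occ_sq_row C j c : is_occ C -> (forall m, incid C j m = (m == c)) ->
  forall i, incid C c i = false.
Proof.
move=> oC h i; rewrite -[RHS](@occ_sq C j i oC).
have ic : incid C j c by rewrite h.
have /andP[_ rc] := incid_rank ic.
rewrite big_mkcond (bigD1_seq c) ?iota_uniq ?mem_iota //= ic big1 ?addbF // => m nm.
by rewrite h (negbTE nm).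
Qed.

Lemma occ_sq_col C i c : is_occ C -> (forall m, incid C m i = (m == c)) ->
  forall j, incid C j c = false.
Proof.
move=> oC h j; rewrite -[RHS](@occ_sq C j i oC).
have ic : incid C c i by rewrite h.
have /andP[rc _] := incid_rank ic.
rewrite big_mkcond (bigD1_seq c) ?iota_uniq ?mem_iota //= h eqxx big1 ?addbF => [|m nm].
  by case: incid.
by rewrite h (negbTE nm) if_same.
Qed.

Lemma simple_rowE C j m : simple_form C -> incid C j m -> forall p, incid C j p = (p == m).
Proof.
by move=> /simple_formP[s1 _] h p; apply/idP/eqP => [h'|->//]; apply: s1 h' h.
Qed.

Lemma simple_chain C j m p : is_occ C -> simple_form C -> incid C j m -> incid C m p = false.
Proof. by move=> oC sC h; apply: (occ_sq_row oC (simple_rowE sC h)). Qed.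

(** No index is both a source and a target, because the boundary squares to zero; so a simple form
    is a matching. *)
Lemma paired_unique C a b c : is_occ C -> simple_form C ->
  paired C a b -> paired C a c -> b = c.
Proof.
move=> oC sC; have [s1 s2] := (simple_formP C).1 sC.
case/orP=> h /orP[h'|h'].
- exact: s1 h h'.
- by move: h; rewrite (simple_chain _ oC sC h').
- by move: h'; rewrite (simple_chain _ oC sC h).
- exact: s2 h h'.
Qed.

Lemma paired_neq C a b : is_occ C -> paired C a b -> a <> b.
Proof. by move=> oC h e; move: h; rewrite e /paired occ_incid_ge. Qed.

(** For a complex in simple form, the second condition says that it is acyclic. *)
Definition simple_paired C : Prop :=
  simple_form C /\ forall j, j < rank C -> exists m, paired C j m.

(** Simplicity forces d y_{i+1} = y_i. So the correction term of the quotient vanishes and, the cusp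
    strands being companions of each other, no other generator loses its companion. *)
Lemma simple_paired_death i C D : is_occ C -> simple_paired C -> death i C D ->
  simple_paired D.
Proof.
move=> oC [sC pC] /(deathE _ _ oC)[rCD hi inc _ hf].
have [s1 s2] := (simple_formP C).1 sC.
have f j m : incid D j m = incid C (up i j) (up i m).
  by rewrite hf (simple_rowE sC inc) (up_neq i m).1 andbF addbF.
split.
  apply/simple_formP; split=> [j m m'|j j' m]; rewrite !f.
    by move=> h1 h2; apply/(@up_inj i)/(s1 _ _ _ h1 h2).
  by move=> h1 h2; apply/(@up_inj i)/(s2 _ _ _ h1 h2).
move=> j rj; have [|m hm] := pC (up i j); first by rewrite rCD up_ltn_rank // -rCD.
have pis : paired C i.+1 i by rewrite /paired inc.
case: (upP i m) => [e|e|m' e]; rewrite e in hm.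
- rewrite pairedC in hm; rewrite pairedC in pis.
  have := paired_unique oC sC hm pis.
  by move=> e'; have := (up_neq i j).2; rewrite e' eqxx.
- rewrite pairedC in hm.
  have := paired_unique oC sC hm pis.
  by move=> e'; have := (up_neq i j).1; rewrite e' eqxx.
- by exists m'; rewrite /paired !f.
Qed.

(** With a simple birth, squaring to zero isolates y_i and y_{i+1} from all other generators: the
    new complex is the old one plus a pair. *)
Lemma simple_paired_birth i C D : is_occ D -> simple_paired C -> birth i C D ->
  (forall m, incid D i.+1 m = (m == i)) -> (forall j, incid D j i = (j == i.+1)) ->
  simple_paired D.
Proof.
move=> oD [sC pC] /(deathE _ _ oD)[rDC hi inc _ hf] f1 f2.
have [s1 s2] := (simple_formP C).1 sC.
have f3 := occ_sq_row oD f1; have f4 := occ_sq_col oD f2.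
have f j m : incid D (up i j) (up i m) = incid C j m.
  by rewrite hf f2 (up_neq i j).2 addbF.
split.
  apply/simple_formP; split=> [j m m'|j j' m].
    case: (upP i j) => [->|->|a ->]; rewrite ?f3 ?f1 //; first by move=> /eqP-> /eqP->.
    case: (upP i m) => [->|->|b ->]; rewrite ?f4 ?f2 ?(up_neq i a).2 //.
    case: (upP i m') => [->|->|c ->]; rewrite ?f4 ?f2 ?(up_neq i a).2 // !f.
    by move=> h1 h2; rewrite (s1 _ _ _ h1 h2).
  case: (upP i m) => [->|->|b ->]; rewrite ?f4 ?f2 //; first by move=> /eqP-> /eqP->.
  case: (upP i j) => [->|->|a ->]; rewrite ?f3 ?f1 ?(up_neq i b).1 //.
  case: (upP i j') => [->|->|c ->]; rewrite ?f3 ?f1 ?(up_neq i b).1 // !f.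
  by move=> h1 h2; rewrite (s2 _ _ _ h1 h2).
move=> j rj; case: (upP i j) => [->|->|a e].
- by exists i.+1; rewrite /paired inc orbT.
- by exists i; rewrite /paired inc.
- have [|m hm] := pC a; first by rewrite -(@up_ltn_rank i) -?rDC // -e.
  by exists (up i m); rewrite e /paired !f.
Qed.

Lemma simple_paired_transp i C D : i.+1 < rank C -> rank C = rank D -> simple_paired C ->
  (forall j m, incid D (transp i j) (transp i m) = incid C j m) -> simple_paired D.
Proof.
move=> hi rCD [sC pC] f; have [s1 s2] := (simple_formP C).1 sC.
have f' j m : incid D j m = incid C (transp i j) (transp i m) by rewrite -f !transpK.
have ti := inv_inj (transpK i).
split.
  apply/simple_formP; split=> [j m m'|j j' m]; rewrite !f' => h1 h2; apply: ti.
    exact: s1 h1 h2.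
  exact: s2 h1 h2.
move=> j rj; have [|m hm] := pC (transp i j); first by rewrite (ltn_transp _ hi) rCD.
by exists (transp i m); rewrite /paired !f' transpK.
Qed.

Lemma simple_paired_eq C D : rank C = rank D -> simple_paired C ->
  (forall j m, incid D j m = incid C j m) -> simple_paired D.
Proof.
move=> rCD [sC pC] f; have [s1 s2] := (simple_formP C).1 sC.
split.
  apply/simple_formP; split=> [j m m'|j j' m]; rewrite !f => h1 h2.
    exact: s1 h1 h2.
  exact: s2 h1 h2.
move=> j; rewrite -rCD => /pC[m hm]; exists m; by rewrite /paired !f.
Qed.

Lemma simple_paired_elementary C : is_occ C -> elementary C -> simple_paired C.
Proof.
move=> oC el; have [r2 f] := elementary_rank_deg oC el.
split.
  apply/simple_formP; split=> [j m m'|j j' m]; rewrite !f;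
    move=> /andP[/eqP h1 /eqP h2] /andP[/eqP h3 /eqP h4].
    by rewrite h2 h4.
  by rewrite h1 h3.
move=> j; rewrite r2; case: j => [|[|//]] _; [exists 1 | exists 0]; by rewrite /paired !f.
Qed.

(** * Crossings in simple form *)

(** The formula of [incid_slide] on bare boolean matrices: the crossing identities become case
    checks free of ranks and degrees. *)
Definition fslide k l (f : nat -> nat -> bool) j m :=
  f j m (+) ((j == k) && f l m) (+) ((m == l) && f j k).

Definition ftransp i (f : nat -> nat -> bool) j m := f (transp i j) (transp i m).

(** Here [f] is a boundary map in simple form in which i is paired with a and
    i + 1 with b; [ba] and [bb] say whether a lies below i and b below i + 1, and
    [g] is the part of [f] that does not involve these four strands. *)
Section CrossingFormulas.
Variables (i a b : nat) (f g : nat -> nat -> bool) (ba bb : bool).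
Hypotheses (ai : a != i) (as' : a != i.+1) (bi : b != i) (bs : b != i.+1) (ab : a != b).

Let four := [:: i; i.+1; a; b].
Hypothesis g0 : forall j m, (j \in four) || (m \in four) -> g j m = false.
Hypothesis fE : forall j m, f j m =
  [&& ba, j == i & m == a] (+) [&& ~~ ba, j == a & m == i] (+)
  [&& bb, j == i.+1 & m == b] (+) [&& ~~ bb, j == b & m == i.+1] (+) g j m.

Let ia : i != a. Proof. by rewrite eq_sym. Qed.
Let sa : i.+1 != a. Proof. by rewrite eq_sym. Qed.
Let ib : i != b. Proof. by rewrite eq_sym. Qed.
Let sb : i.+1 != b. Proof. by rewrite eq_sym. Qed.
Let ba' : b != a. Proof. by rewrite eq_sym. Qed.
Let is' : i != i.+1. Proof. by rewrite neq_ltn ltnSn. Qed.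
Let si : i.+1 != i. Proof. by rewrite eq_sym. Qed.

Let gE : (forall x, g i x = false) * (forall x, g i.+1 x = false) *
  (forall x, g a x = false) * (forall x, g b x = false) *
  (forall x, g x i = false) * (forall x, g x i.+1 = false) *
  (forall x, g x a = false) * (forall x, g x b = false).
Proof. by do !split; move=> x; apply: g0; rewrite !inE eqxx ?orbT. Qed.

Ltac simpl_eq :=
  repeat match goal with
  | H : is_true (?x != ?y) |- context [?x == ?y] => rewrite (negbTE H) /=
  | |- context [?x == ?x] => rewrite eqxx /=
  end.

Ltac split_index j :=
  let h1 := fresh in let h2 := fresh in let h3 := fresh in let h4 := fresh in
  case: (eqVneq j i) => [->|h1];
    [|case: (eqVneq j i.+1) => [->|h2];
    [|case: (eqVneq j a) => [->|h3];
    [|case: (eqVneq j b) => [->|h4]]]].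

Ltac five_cases j m :=
  rewrite /fslide /ftransp /transp;
  split_index j; simpl_eq; split_index m; simpl_eq;
  rewrite !fE; simpl_eq; rewrite ?gE ?andbF ?andbT //=.

(** Slide, transposition and slide together add row i+1 to row i and column i to column i+1. Both
    added lines vanish: y_{i+1} is the boundary of y_b, and y_a that of y_i. *)
Lemma slide_transp_disjoint : ba -> ~~ bb -> forall j m,
  fslide i.+1 i (ftransp i (fslide i.+1 i f)) j m = f j m.
Proof.
move=> hba /negbTE hbb j m; five_cases j m; rewrite ?hba ?hbb //=;
by case: (g j m).
Qed.

(** Here y_i is the boundary of y_a and y_b that of y_{i+1}, so the slide adds a zero row i and a
    zero column i+1. *)
Lemma slide_transp_interleaved : ~~ ba -> bb -> forall j m,
  ftransp i (fslide i.+1 i f) (transp i j) (transp i m) = f j m.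
Proof.
move=> /negbTE hba hbb j m; rewrite /ftransp !transpK.
five_cases j m; rewrite ?hba ?hbb //=;
by case: (g j m).
Qed.

(** The opposite slide creates one wrong entry, (i, b) if the companions lie below and (a, i+1) if
    they lie above; [h_{a,b}] removes it. *)
Lemma slide_transp_nested : ba = bb -> forall j m,
  fslide a b (fslide i.+1 i (ftransp i (fslide i.+1 i f))) j m = f j m.
Proof.
move=> e j m; five_cases j m; rewrite ?e; case: bb => //=;
by case: (g j m).
Qed.

(** In positions before the crossing, the slide creates the entry (i+1, a) if the companions lie
    below and (b, i) if they lie above; [h_{b,a}] removes it. *)
Lemma slide_transp_overlapping : ba = bb -> forall j m,
  fslide b a (ftransp i (fslide i.+1 i f)) (transp i j) (transp i m) = f j m.
Proof.
move=> e j m; rewrite /ftransp /fslide !transpK -!/(transp i _).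
five_cases j m; rewrite ?e; case: bb => //=;
by case: (g j m).
Qed.

End CrossingFormulas.

Lemma incid_fslide C k l j m : is_occ C -> slidable C (k, l) ->
  incid (slide (k, l) C) j m = fslide k l (incid C) j m.
Proof. exact: incid_slide. Qed.

Lemma paired_incid C a b : is_occ C -> paired C a b -> incid C a b = (b < a).
Proof.
move=> oC /orP[h|h]; first by rewrite h; have [-> _] := occ_incid oC h.
have [lt _] := occ_incid oC h.
by rewrite occ_incid_ge ?(ltnW lt) // ltnNge (ltnW lt).
Qed.

(** The pairing fixes the rows and columns of the four strands, and the order gives the direction of
    each pair, since boundaries point to smaller indices. *)
Lemma incid_two_pairs C i s a b : is_occ C -> simple_form C ->
  paired C i a -> paired C s b -> i != s -> i != a -> i != b -> s != a -> s != b -> a != b ->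
  forall j m, incid C j m =
    [&& a < i, j == i & m == a] (+) [&& ~~ (a < i), j == a & m == i] (+)
    [&& b < s, j == s & m == b] (+) [&& ~~ (b < s), j == b & m == s] (+)
    [&& incid C j m, j \notin [:: i; s; a; b] & m \notin [:: i; s; a; b]].
Proof.
move=> oC sC pi ps nis nia nib nsa nsb nab.
have inva x y : paired C x y -> forall p, paired C x p = (p == y).
  by move=> h p; apply/idP/eqP => [h'|->//]; apply: paired_unique h' h.
have key x y j m : paired C x y -> (j == x) || (m == x) ->
    incid C j m = [&& y < x, j == x & m == y] (+) [&& ~~ (y < x), j == y & m == x].
  move=> h; have nxy := paired_neq oC h.
  have lxy : (x < y) = ~~ (y < x) by rewrite ltn_neqAle -leqNgt; case: eqP.
  case/orP=> /eqP->.
    rewrite eqxx /=; have -> : (x == y) = false by apply/eqP.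
    rewrite /= andbF addbF; have := inva _ _ h m.
    case: eqVneq => [->|_]; first by rewrite andbT (paired_incid oC h).
    by rewrite andbF /paired; case: (incid C x m).
  rewrite eqxx andbT; have -> : (x == y) = false by apply/eqP.
  rewrite !andbF /=; have := inva _ _ h j.
  case: eqVneq => [->|_].
    by rewrite andbT pairedC => h'; rewrite (paired_incid oC h') lxy.
  by rewrite andbF /paired orbC; case: (incid C j x).
have pa : paired C a i by rewrite pairedC.
have pb : paired C b s by rewrite pairedC.
have la : (i < a) = ~~ (a < i) by rewrite ltn_neqAle -leqNgt nia.
have lb : (s < b) = ~~ (b < s) by rewrite ltn_neqAle -leqNgt nsb.
move=> j m.
case hj : (j \in [:: i; s; a; b]).
  rewrite andbF addbF; move: hj; rewrite !inE.
  case/or4P=> /eqP->.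
  - rewrite (key i a) ?eqxx // (negbTE nis) (negbTE nib) (negbTE nia) /=.
    by rewrite !andbF /= !addbF.
  - rewrite (key s b) ?eqxx // (eq_sym s i) (negbTE nis) (negbTE nsa) (negbTE nsb) /=.
    by rewrite !andbF.
  - rewrite (key a i) ?eqxx // la negbK (eq_sym a i) (eq_sym a s) (negbTE nia).
    by rewrite (negbTE nsa) (negbTE nab) /= !andbF /= !addbF.
  - rewrite (key b s) ?eqxx // lb negbK (eq_sym b i) (eq_sym b s) (eq_sym b a).
    by rewrite (negbTE nib) (negbTE nsb) (negbTE nab) /= !andbF /= !addbF.
have /and4P[ji js ja jb] : [&& j != i, j != s, j != a & j != b].
  by move: (negbT hj); rewrite !inE !negb_or.
rewrite (negbTE ji) (negbTE js) (negbTE ja) (negbTE jb) !andbF /=.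
case hm : (m \in [:: i; s; a; b]); last by rewrite andbT.
rewrite andbF; move: hm; rewrite !inE; case/or4P=> /eqP->.
- by rewrite (key i a) ?eqxx ?orbT // (negbTE ji) (negbTE ja) !andbF.
- by rewrite (key s b) ?eqxx ?orbT // (negbTE js) (negbTE jb) !andbF.
- by rewrite (key a i) ?eqxx ?orbT // (negbTE ji) (negbTE ja) !andbF.
- by rewrite (key b s) ?eqxx ?orbT // (negbTE js) (negbTE jb) !andbF.
Qed.

Section Crossing.
Variables (C D : occ) (i : nat) (swapped : bool).
Let P := swap_word i swapped.
Hypotheses (oC : is_occ C) (oD : is_occ D) (spC : simple_paired C) (wP : word C P)
  (hD : Defs.interchange i (slides C P) D).

Let oP : is_occ (slides C P). Proof. exact: is_occ_slides. Qed.
Let sC : simple_form C. Proof. by case: spC. Qed.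

Let rCD : rank C = rank D.
Proof. by have [e _ _ _] := (interchangeP _ _ _).1 hD; rewrite -e rank_slides. Qed.

Let hi : i.+1 < rank C.
Proof. by have [_ h _ _] := (interchangeP _ _ _).1 hD; rewrite rank_slides in h. Qed.

Let degD j : degn D (transp i j) = degn C j.
Proof. by have [_ _ h _] := (interchangeP _ _ _).1 hD; rewrite h degn_slides. Qed.

Let incD j m : incid D j m = ftransp i (incid (slides C P)) j m.
Proof. by have [_ _ _ h] := (interchangeP _ _ _).1 hD; rewrite /ftransp -h !transpK. Qed.

Let transp_i : transp i i = i.+1. Proof. by rewrite /transp eqxx. Qed.
Let transp_s : transp i i.+1 = i. Proof. by rewrite /transp eqxx (gtn_eqF (ltnSn i)). Qed.

(** An entry (i+1, i) would survive the slides and land above the diagonal of [D]. Hence i and i+1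
    are not companions, and i, i+1, a, b are distinct. *)
Let inc_si : incid C i.+1 i = false.
Proof.
rewrite -(incid_slides_succ i oC wP) -[RHS](@occ_incid_ge D i i.+1) //.
by rewrite incD /ftransp transp_i transp_s.
Qed.

Variables (a b : nat).
Hypotheses (pa : paired C i a) (pb : paired C i.+1 b).

Let nia : i != a. Proof. by apply/eqP/(paired_neq oC pa). Qed.
Let nsb : i.+1 != b. Proof. by apply/eqP/(paired_neq oC pb). Qed.
Let nsa : i.+1 != a.
Proof.
apply/eqP => e; move: pa; rewrite -e /paired inc_si.
by rewrite occ_incid_ge.
Qed.
Let nib : i != b.
Proof.
apply/eqP => e; move: pb; rewrite -e /paired inc_si.
by rewrite occ_incid_ge.
Qed.
Let nis : i != i.+1. Proof. by rewrite neq_ltn ltnSn. Qed.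
Let nab : a != b.
Proof.
apply/eqP => e; move: pa pb; rewrite -e pairedC => h; rewrite pairedC => h'.
by have := paired_unique oC sC h h'; apply/eqP.
Qed.

Lemma transp_companions : (transp i a = a) * (transp i b = b).
Proof.
rewrite /transp ![_ == i]eq_sym ![_ == i.+1]eq_sym.
by rewrite (negbTE nia) (negbTE nsa) (negbTE nib) (negbTE nsb).
Qed.

Lemma crossing_companions x y : companions (final C (run C P)) x y <-> paired C x y.
Proof. by rewrite final_run; apply: companionsP => //; apply: handleslides_slides_back. Qed.

Lemma companions_after V x y : word D V -> simple_form (slides D V) ->
  (companions D x y <-> paired (slides D V) x y).
Proof. by move=> wV sV; apply: companionsP => //; apply: handleslides_slides. Qed.

Lemma switch_same V : word D V -> (forall j m, incid (slides D V) j m = incid C j m) ->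
  is_switch (final C (run C P)) D /\ simple_paired (slides D V).
Proof.
move=> wV e; have sp : simple_paired (slides D V).
  by apply: simple_paired_eq e => //; rewrite rank_slides.
split=> // x y; rewrite crossing_companions (companions_after x y wV (proj1 sp)).
by rewrite /paired !e.
Qed.

(** After the crossing, position i carries the former strand i+1; were it still paired with a, then
    a = b. *)
Lemma not_switch_transposed V : word D V ->
  (forall j m, incid (slides D V) (transp i j) (transp i m) = incid C j m) ->
  ~ is_switch (final C (run C P)) D /\ simple_paired (slides D V).
Proof.
move=> wV e; have sp : simple_paired (slides D V).
  by apply: (simple_paired_transp hi) e => //; rewrite rank_slides.
split=> // sw.
have h := (companions_after _ _ wV (proj1 sp)).1 ((sw _ _).1 ((crossing_companions _ _).2 pa)).
have h' : paired C i.+1 a.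
  by move: h; rewrite /paired -{1 2}transp_s -{1 2}transp_companions.1 !e.
by have := paired_unique oC sC h' pb; apply/eqP.
Qed.

Lemma is_return_overlap V : word D V ->
  (forall j m, incid (slides D V) (transp i j) (transp i m) = incid C j m) ->
  partial_overlap i a i.+1 b -> is_return (final C (run C P)) i D.
Proof.
move=> wV e ov; split; first by case: (not_switch_transposed wV e).
by exists a, b; split=> //; apply/crossing_companions.
Qed.

(** On one side both companions are sources or both are targets, so their degrees shift alike from
    those of i and i+1. *)
Lemma slidable_companions : degn C i = degn C i.+1 -> same_side i a b ->
  slidable D (maxn a b, minn a b).
Proof.
move=> di ss.
have dab : degn D a = degn D b.
  rewrite -{1}transp_companions.1 -{1}transp_companions.2 !degD.
  move: pa pb; rewrite /paired => /orP[ha|ha] /orP[hb|hb];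
    have [l1 d1] := occ_incid oC ha; have [l2 d2] := occ_incid oC hb.
  - by apply: (addIr (1%R : int)); rewrite -d1 -d2.
  - by move: ss; rewrite /same_side; lia.
  - by move: ss; rewrite /same_side; lia.
  - by rewrite d1 d2 di.
have ra : a < rank D by rewrite -rCD; case/orP: pa => /incid_rank /andP[].
have rb : b < rank D by rewrite -rCD; case/orP: pb => /incid_rank /andP[].
rewrite /slidable /=; case: (ltngtP a b) => [lab|lba|eab].
- by rewrite lab rb dab eqxx.
- by rewrite lba ra dab eqxx.
- by move: nab; rewrite eab eqxx.
Qed.


Lemma swapped_degree : swapped -> degn C i = degn C i.+1.
Proof. by move: wP; rewrite /P; case: swapped => //= /andP[/and3P[_ _ /eqP]]. Qed.

Lemma crossing_word : exists2 V, word D V &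
  simple_paired (slides D V) /\
  (simple_switch C (run C P) i D (run D V) \/ simple_return C (run C P) i D (run D V) \/
    plain_crossing C (run C P) i D (run D V)).
Proof.
have cC x y := crossing_companions x y.
have [w0|[V wV]] : swapped = false \/ exists2 V, word D V & swapped /\
   ((forall j m, incid (slides D V) j m = incid C j m) /\
    V = (if same_side i a b then [:: (i.+1, i); (maxn a b, minn a b)] else [:: (i.+1, i)])
    \/
    (forall j m, incid (slides D V) (transp i j) (transp i m) = incid C j m) /\
    V = (if same_side i a b then [:: (maxn a b, minn a b)] else [::]) /\
    partial_overlap i a i.+1 b).
- case e : swapped; [right | by left].
  have di := swapped_degree e.
  have sPw : slidable C (i.+1, i) by move: wP; rewrite /P e => /andP[].
  have sD : slidable D (i.+1, i).
    rewrite /slidable /= -rCD hi ltnSn -{1}transp_i -[in X in _ == X]transp_s !degD di.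
    by rewrite eqxx.
  pose g j m := [&& incid C j m, j \notin [:: i; i.+1; a; b] & m \notin [:: i; i.+1; a; b]].
  have fE := incid_two_pairs oC sC pa pb nis nia nib nsa nsb nab; rewrite -/(g _ _) in fE.
  have g0 j m : (j \in [:: i; i.+1; a; b]) || (m \in [:: i; i.+1; a; b]) -> g j m = false.
    by rewrite /g; case: (j \in _); case: (m \in _) => //=; rewrite ?andbF.
  have [ai as' bi bs] : [/\ a != i, a != i.+1, b != i & b != i.+1].
    by rewrite ![_ == i]eq_sym ![_ == i.+1]eq_sym.
  have iD j m : incid D j m = ftransp i (fslide i.+1 i (incid C)) j m.
    by rewrite incD /ftransp /P e /= incid_fslide.
  have oD1 := is_occ_slide oD sD.
  have iD1 j m : incid (slide (i.+1, i) D) j m =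
      fslide i.+1 i (ftransp i (fslide i.+1 i (incid C))) j m.
    by rewrite incid_fslide // /fslide !iD.
  case ss : (same_side i a b).
    have sM := slidable_companions di ss.
    have eb : (a < i) = (b < i.+1) by move: ss nib; rewrite /same_side; lia.
    (* With both companions on one side, a < b makes the two disks overlap partially and b < a nests
       them. *)
    case: (ltngtP a b) sM => [lab|lba|eab] sM; last by move: nab; rewrite eab eqxx.
      exists [:: (b, a)]; first by rewrite /word /= sM.
      split=> //; right; split.
        move=> j m; rewrite /= incid_fslide // /fslide !iD.
        exact: (slide_transp_overlapping ai as' bi bs nab g0 fE eb).
      split=> //; move: ss lab nib nia nsa nsb; rewrite /same_side /partial_overlap; lia.
    exists [:: (i.+1, i); (a, b)]; first by rewrite /word /= sM sD.
    split=> //; left; split=> //.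
    move=> j m; rewrite /= incid_fslide // /fslide !iD1.
    exact: (slide_transp_nested ai as' bi bs nab g0 fE eb).
  (* Companions on opposite sides: a below and b above gives disjoint disks, the other case a
     partial overlap. *)
  case ba : (a < i).
    exists [:: (i.+1, i)]; first by rewrite /word /= sD.
    split=> //; left; split=> // j m; rewrite /= iD1.
    apply: (slide_transp_disjoint ai as' bi bs nab g0 fE ba).
    by move: ss ba nib nsb; rewrite /same_side; lia.
  exists [::] => //; split=> //; right; split.
    move=> j m; rewrite /= iD.
    apply: (slide_transp_interleaved ai as' bi bs nab g0 fE); first by rewrite ba.
    by move: ss ba nib nsb nia nsa; rewrite /same_side; lia.
  split=> //; move: ss ba nib nia nsa nsb; rewrite /same_side /partial_overlap; lia.
(* Without a surviving mark [D] is already the transposed complex, so the crossing is not a switch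
   and no mark is added. *)
- have eP : P = [::] by rewrite /P w0.
  have e j m : incid (slides D [::]) (transp i j) (transp i m) = incid C j m.
    by rewrite /= incD /ftransp !transpK eP.
  exists [::] => //; have [nsw sp] := @not_switch_transposed [::] isT e.
  split=> //; right.
  case ov : (partial_overlap i a i.+1 b).
    left; split=> //; first exact: (@is_return_overlap [::]).
    - by case: sp.
    - by left; rewrite eP.
  right; rewrite eP in nsw *; split=> //; case; case=> _ [a' [b' [h1 h2 h3]]] _.
  have h1' : paired C i a' by apply/cC; rewrite eP.
  have h2' : paired C i.+1 b' by apply/cC; rewrite eP.
  move: h3; rewrite -(paired_unique oC sC pa h1') -(paired_unique oC sC pb h2').
  by rewrite ov.
- case=> e [[h eV]|[h [eV ov]]]; exists V => //.
    have [sw sp] := switch_same wV h; split=> //; left; split=> //.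
    - by rewrite final_run; case: sp.
    - by rewrite events_run /P e.
    - exists a, b; split; [exact/cC | exact/cC |].
      by rewrite events_run eV; case: (same_side i a b) => //; left.
  have [nsw sp] := not_switch_transposed wV h; split=> //; right; left; split=> //.
  - exact: is_return_overlap wV h ov.
  - by rewrite final_run; case: sp.
  - right; split; first by rewrite events_run /P e.
    exists a, b; split; [exact/cC | exact/cC |].
    by rewrite events_run eV; case: (same_side i a b).
Qed.

End Crossing.

(** * The sweep to SR-form *)

(** The marks that simplify the complex after a crossing are inserted together with their inverse,
    which then joins the swept word. *)
Lemma word_rev_cancel C V : is_occ C -> word C V -> word_equiv C [::] (V ++ rev V).
Proof.
elim/last_ind: V => [|V x IH] oC; first by move=> _; apply: word_equiv_refl.
rewrite /word all_rcons => /andP[sx wV].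
apply: word_equiv_trans (IH oC wV) _; rewrite rev_rcons -cats1 -catA.
apply: (@word_equiv_ctx _ V [::] [:: x; x] (rev V)) => //; first by rewrite /word all_rev.
apply: word_equiv_sym; apply: word_cancel; rewrite ?slidable_slides //.
exact: is_occ_slides.
Qed.

Lemma sr_decomposition_cat C q q' : sr_decomposition C q ->
  sr_decomposition (final C q) q' -> sr_decomposition C (q ++ q').
Proof.
elim=> {C q} [//|C k B q _ IH h|C k B q _ IH h|C p i D r q hq _ IH h].
- exact/SrLeftCusp/IH.
- exact/SrRightCusp/IH.
- rewrite -catA cat_cons -catA; apply: SrCrossing => //; apply: IH.
  suff <- : final C (p ++ (Cr i, D) :: r ++ q) = final (final D r) q by [].
  by rewrite final_cat -[LHS]/(final D (r ++ q)) final_cat.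
Qed.

Lemma simple_birth_run C V : all_tails simple_birth_at (run C V).
Proof. by elim: V C => //= x V IH C. Qed.

Lemma sr_form_sweep C V q : is_occ C -> simple_paired C -> word C V -> vsteps (slides C V) q ->
  exists q' W, [/\ all_tails simple_birth_at q' /\ sr_decomposition C q',
    word (final C q') W & tail_equiv C (run C V ++ q) (q' ++ run (final C q') W)].
Proof.
apply: (@sweep simple_paired
   (fun C q => all_tails simple_birth_at q /\ sr_decomposition C q)).
- by move=> {}C; split=> //; constructor.
- move=> {V q} {}C q q' [h1 h2] [h3 h4]; split; first exact: all_tails_cat.
  exact: sr_decomposition_cat.
move=> {q} {}C {}V [//|i|i|i] D oC oD spC wV _ h.
- have [b [D' [W [wP h' oD' wW E]]]] := crossing_pass oC oD wV h.
  have [rCD hi _ _] := (interchangeP _ _ _).1 h'.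
  have [_ pC] := spC; rewrite rank_slides in hi.
  have [a pa] := pC _ (ltnW hi); have [c pc] := pC _ hi.
  have [U wU [spU cr]] := crossing_word oC oD' spC wP h' pa pc.
  have oU := is_occ_slides oD' wU.
  exists (run C (swap_word i b) ++ (Cr i, D') :: run D' U), (rev U ++ W).
  have eF : final C (run C (swap_word i b) ++ (Cr i, D') :: run D' U) = slides D' U.
    by rewrite final_cat -[final _ _]/(final D' (run D' U)) final_run.
  rewrite eF; split=> //.
  + split.
      apply: all_tails_cat => //; first exact: simple_birth_run.
      by split=> //; apply: simple_birth_run.
    rewrite -[run D' U]cats0; apply: SrCrossing => //; constructor.
  + by rewrite word_slides word_cat wW andbT /word all_rev.
  + apply: tail_equiv_trans E _; rewrite -catA; apply: tail_equiv_catl; first exact: vsteps_run.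
    have [_ _ E2] : word_equiv D' W ((U ++ rev U) ++ W).
      by apply: (@word_equiv_catr _ W [::]) => //; apply: word_rev_cancel.
    rewrite -catA run_cat in E2.
    apply: (@tail_equiv_catl _ [:: (Cr i, D')] _ _ _ E2).
    by split=> //; rewrite final_run.
- have [D' [W [h' oD' wW E]]] := right_cusp_pass oC oD wV h.
  exists [:: (Rc i, D')], W; split=> //.
    by split=> //; apply: SrRightCusp; constructor.
  exact: simple_paired_death h'.
- have [D' [W [h' oD' wW fs E]]] := left_cusp_pass oC oD wV h.
  exists [:: (Lc i, D')], W; split=> //.
    split; last by apply: SrLeftCusp; constructor.
    by split=> //; case: fs; apply: simple_birthP.
  by case: fs; apply: simple_paired_birth h'.
Qed.

Lemma sr_form_exists (R : realType) (K : space_curve R) (mu : R -> int) M : is_mcs K mu M ->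
  exists M', [/\ is_mcs K mu M', mcs_equiv K mu M M' & sr_form M'].
Proof.
case: M => C t hM; have [oC v] := is_mcs_vsteps hM.
have spC : simple_paired C by apply: simple_paired_elementary => //; case: hM.
have [q [h1 h2 [b m]]] := mcs_normalize hM (@sr_form_sweep C [::] t oC spC isT v).
exists (Mcs C q); split=> //; split=> //.
by move=> p k B q' e; apply: (all_tailsP b e).
Qed.

Theorem theorem1p6 (R : realType) (K : space_curve R) (mu : R -> int) (M : mcs) :
  legendrian_knot K -> sigma_generic K -> maslov_potential K mu ->
  is_mcs K mu M ->
  (exists M', [/\ is_mcs K mu M', mcs_equiv K mu M M' & sr_form M']) /\
  (exists M', [/\ is_mcs K mu M', mcs_equiv K mu M M' & a_form M']).
Proof.
by move=> _ _ _ hM; split; [exact: sr_form_exists | exact: a_form_exists].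
Qed.
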